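(* Let $H$, $A$, $m$ be as in the context. Assume that for some $(u_0,u_1)\in D(A^{3/4})\times D(A^{1/4})$ the problem $$u''(t)+m\left(|A^{1/2}u(t)|^2\right)Au(t)=0,\qquad u(0)=u_0,\quad u'(0)=u_1,$$ admits a global solution $u$ (defined for all $t\ge0$). Then for every family $\{(u_{0\varepsilon},u_{1\varepsilon})\}_{\varepsilon>0}\subseteq D(A^{3/4})\times D(A^{1/4})$ converging to $(u_0,u_1)$ in $D(A^{3/4})\times D(A^{1/4})$ as $\varepsilon\to0^+$ it turns out that $$\lim_{\varepsilon\to0^+}\mathcal{LS}(u_{0\varepsilon},u_{1\varepsilon})=+\infty,$$ and, denoting by $u_\varepsilon$ the solution with initial data $(u_{0\varepsilon},u_{1\varepsilon})$, $E_{(u_\varepsilon-u)}(t)\to0$ as $\varepsilon\to0^+$ uniformly on all bounded time intervals.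
   Context: Standing assumptions. $H$ is a real Hilbert space with norm $|\cdot|$ and inner product $\langle\cdot,\cdot\rangle$. $A$ is a self-adjoint operator on $H$ with domain $D(A)$ for which there are an orthonormal basis $\{e_k\}_{k\ge1}$ of $H$ and a sequence $\{\lambda_k\}$ of nonnegative reals with $Ae_k=\lambda_k^2e_k$ for all $k$. For $\alpha\ge0$, $D(A^\alpha)=\{z\in H:\sum_k\lambda_k^{4\alpha}\langle z,e_k\rangle^2<\infty\}$ with the graph norm, and $A^\alpha z=\sum_k\lambda_k^{2\alpha}\langle z,e_k\rangle e_k$. The function $m:[0,+\infty)\to\mathbb{R}$ is of class $C^1$ and there is a constant $\nu_0>0$ with $m(\sigma)\ge\nu_0$ for all $\sigma\ge0$. Solutions. A solution on an interval $[0,T]$ is a function $u\in C^0([0,T],D(A^{3/4}))\cap C^1([0,T],D(A^{1/4}))$ satisfying $u''+m(|A^{1/2}u|^2)Au=0$ componentwise: each $u_k(t)=\langle u(t),e_k\rangle$ satisfies $u_k''+m(|A^{1/2}u(t)|^2)\lambda_k^2u_k=0$. Known local theory: for every $(u_0,u_1)\in D(A^{3/4})\times D(A^{1/4})$ there is a unique solution with $u(0)=u_0$, $u'(0)=u_1$ on some $[0,T]$, $T>0$; the quantity $|u'(t)|^2+\int_0^{|A^{1/2}u(t)|^2}m(s)\,ds$ is constant in $t$; if $(u_0,u_1)\in D(A^{\alpha+3/4})\times D(A^{\alpha+1/4})$ with $\alpha\ge0$ then $u\in C^0([0,T],D(A^{\alpha+3/4}))\cap C^1([0,T],D(A^{\alpha+1/4}))$;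 and the solution extends to a maximal interval $[0,T_{\max})$ where either $T_{\max}=+\infty$ or $\limsup_{t\to T_{\max}^-}(|A^{1/4}u'(t)|^2+|A^{3/4}u(t)|^2)=+\infty$. The life span is $\mathcal{LS}(u_0,u_1):=T_{\max}\in(0,+\infty]$; the solution is global when it equals $+\infty$. Energy. For a function $z$ in $C^0([0,T],D(A^{3/4}))\cap C^1([0,T],D(A^{1/4}))$, $E_z(t):=|z'(t)|^2+|A^{1/4}z'(t)|^2+|A^{1/2}z(t)|^2+|A^{3/4}z(t)|^2$. (On a bounded interval $[0,T]$ the difference $u_\varepsilon-u$ is considered for those small $\varepsilon$ for which $u_\varepsilon$ is defined on $[0,T]$.) *)

(* Defs.v *)
From HB Require Import structures.
From mathcomp Require Import all_boot all_order all_algebra.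
From mathcomp Require Import all_classical all_reals all_analysis.

Set Implicit Arguments.
Unset Strict Implicit.
Unset Printing Implicit Defensive.

Import Order.TTheory GRing.Theory Num.Theory.
Import numFieldNormedType.Exports.

Local Open Scope classical_set_scope.
Local Open Scope ring_scope.

(** A real Hilbert space is a complete normed module over [R : realType] whose
    norm comes from a dot product, see [norm_from_dot]. *)

Section Hilbert.
Context {R : realType} {H : completeNormedModType R}.
Implicit Types (dot : {dot H for idfun}) (x y z : H) (D : set H) (A : H -> H).

Definition norm_from_dot dot := forall x, `|x| ^+ 2 = dot x x.

Definition orthonormal_basis dot (e : nat -> H) :=
  (forall i j, dot (e i) (e j) = (i == j)%:R) /\
  (forall x, series (fun k => dot x (e k) *: e k) @ \oo --> x).

(** An unbounded operator is a function on [H] of which only the values on the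
    domain [D] are meaningful. *)
Definition linear_on D A :=
  D 0 /\
  forall (a : R) x y, D x -> D y ->
    D (a *: x + y) /\ A (a *: x + y) = a *: A x + A y.

(** [adjoint_rel dot D A y z] means that y is in the domain of the adjoint of
    (D, A) and that the adjoint maps y to z. *)
Definition adjoint_rel dot D A y z := forall x, D x -> dot (A x) y = dot x z.

Definition self_adjoint dot D A :=
  [/\ linear_on D A, dense D &
      forall y z, adjoint_rel dot D A y z <-> D y /\ A y = z].

End Hilbert.

(** Derivatives and continuity relative to an interval [I]: at an endpoint
    belonging to [I] they are one-sided. *)

Section RelativeDerivative.
Context {R : realType}.
Implicit Types (I : set R) (f : R -> R).

Definition has_deriv_on I f f' :=
  forall t, I t -> (f s - f t) / (s - t) @[s --> within I t^'] --> f' t.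

Definition has_deriv2_on I f f'' :=
  exists2 f', has_deriv_on I f f' & has_deriv_on I f' f''.

Definition class_C1_on I f :=
  exists2 f', has_deriv_on I f f' & {within I, continuous f'}.

End RelativeDerivative.

Section Kirchhoff.
Context {R : realType} {H : completeNormedModType R}.
Variables (dot : {dot H for idfun}) (e : nat -> H) (lam : nat -> R) (m : R -> R).
Implicit Types (a T : R) (I : set R) (z : H).

(** The powers A^a (a >= 0) of the operator with A e_k = lam_k^2 e_k.  Since
    0 `^ 0 = 1, the power A^0 is the identity even when some lam_k vanish. *)
Definition dom_pow a : set H :=
  [set z | cvgn (series (fun k => lam k `^ (4 * a) * dot z (e k) ^+ 2))].

Definition op_pow a z : H :=
  limn (series (fun k => (lam k `^ (2 * a) * dot z (e k)) *: e k)).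

Definition graph_norm a z : R := Num.sqrt (`|z| ^+ 2 + `|op_pow a z| ^+ 2).

(** C^0(I, D(A^a)) *)
Definition C0_dom_pow I a (u : R -> H) :=
  (forall t, I t -> dom_pow a (u t)) /\
  (forall t, I t -> graph_norm a (u s - u t) @[s --> within I (nbhs t)] --> 0).

(** u belongs to C^1(I, D(A^a)) and has derivative u' *)
Definition C1_dom_pow I a (u u' : R -> H) :=
  [/\ C0_dom_pow I a u,
      (forall t, I t ->
         graph_norm a ((s - t)^-1 *: (u s - u t) - u' t)
           @[s --> within I t^'] --> 0) &
      C0_dom_pow I a u'].

(** Solutions on [0, T] are given together with their derivative u'. *)
Definition solution_on T u0 u1 (u u' : R -> H) :=
  [/\ C0_dom_pow `[0, T] (3 / 4) u,
      C1_dom_pow `[0, T] (1 / 4) u u',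
      (forall k, has_deriv2_on `[0, T] (fun t => dot (u t) (e k))
         (fun t => - (m (`|op_pow (1 / 2) (u t)| ^+ 2)
                      * lam k ^+ 2 * dot (u t) (e k)))),
      u 0 = u0 & u' 0 = u1].

Definition global_solution u0 u1 (u u' : R -> H) :=
  forall T, 0 < T -> solution_on T u0 u1 u u'.

(** The right end T_max of the maximal interval of existence [0, T_max[. *)
Definition life_span u0 u1 : \bar R :=
  ereal_sup [set T%:E | T in
    [set T | 0 < T /\ exists u u', solution_on T u0 u1 u u']].

(** (u, u') is the solution on the whole of [0, T_max[. *)
Definition maximal_solution u0 u1 (u u' : R -> H) :=
  forall T, 0 < T -> (T%:E < life_span u0 u1)%E -> solution_on T u0 u1 u u'.

(** z' is the derivative of z *)
Definition energy (z z' : R -> H) (t : R) : R :=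
  `|z' t| ^+ 2 + `|op_pow (1 / 4) (z' t)| ^+ 2
  + `|op_pow (1 / 2) (z t)| ^+ 2 + `|op_pow (3 / 4) (z t)| ^+ 2.

End Kirchhoff.

(* Main.v *)
Require Import Defs.
From HB Require Import structures.
From mathcomp Require Import all_boot all_order all_algebra.
From mathcomp Require Import all_classical all_reals all_analysis.
From mathcomp Require Import ring lra.

Set Implicit Arguments.
Unset Strict Implicit.
Unset Printing Implicit Defensive.

Import Order.TTheory GRing.Theory Num.Theory.
Import numFieldNormedType.Exports.

Local Open Scope classical_set_scope.
Local Open Scope ring_scope.

(** Why the theorem holds.  In the basis e the equation decouples into the
    scalar equations v_k'' + c(t) lam_k^2 v_k = 0, coupled only through the
    scalar function c(t) = m(sigma(t)), sigma(t) = sum_k lam_k^2 v_k(t)^2.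
    The energy of the statement is the sum over k of (1 + lam_k) N_k(t) with
    N_k = v_k'^2 + lam_k^2 v_k^2.

    Everything rests on estimates for one mode with a constant that depends on c
    only through lower and upper bounds and a Lipschitz constant.  First, N_k(t)
    is at most C N_k(0) [mode_energy_growth].  Secondly, if two coefficients
    differ by at most D exp(mu t), then N_k of the difference of the solutions
    is at most C exp(2 mu t) (initial value + (D / mu)^2 lam_k^2 N_k(0))
    [mode_energy_perturbation].  The factor lam_k^2 is the usual loss of
    derivatives of quasilinear equations, and it is harmless for two reasons.
    In the difference of the two functions sigma it meets lam_k (v_k + w_k), so
    that only the weight 1 + lam_k survives, which the energy controls
    [mode_square_diff, sigma_dist].  In the energy itself the high modes are
    dominated, uniformly in time, by the initial energies, while the factor
    D / mu makes the contribution of the low modes small [energy_stability,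
    low_modes_weight_cvg0].

    Let p be the global solution and c_p its coefficient on [0, T].  For initial
    data near those of p consider the map sending a Lipschitz function c to
    m(sigma) for the linear modes with coefficient c.  On a small ball around c_p
    for the norm sup_t exp(-mu t) |.| these modes have energy close to that of
    p, hence m(sigma) is Lipschitz with a constant fixed in advance; for mu large
    the map contracts and, the data being close, preserves the ball.  Its fixed
    point is a solution on all of [0, T] which is close to p in energy
    [nonlinear_modes_stability].  Thus existence up to time T and closeness to p
    come together, with no continuation argument; the life span tends to
    infinity because T is arbitrary.  The same contraction gives uniqueness
    [nonlinear_coefficient_unique], which identifies the given solutions with
    those constructed.  Parseval and Riesz-Fischer translate between families of
    modes and functions with values in H [solution_modes,
    modes_realization]. *)

(** * Derivatives relative to a set of reals *)

Section Calculus.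
Context {R : realType}.
Implicit Types (I : set R) (f g : R -> R) (t l a b : R).

Definition has_deriv_at I f t l :=
  (f s - f t) / (s - t) @[s --> within I t^'] --> l.

(** Clearing the denominator makes the point s = t harmless. *)
Lemma has_deriv_atP I f t l : has_deriv_at I f t l <->
  forall eta, 0 < eta -> exists2 d, 0 < d &
    forall s, I s -> `|s - t| < d -> `|f s - f t - l * (s - t)| <= eta * `|s - t|.
Proof.
split=> [h eta eta0|h].
  move/cvgrPdist_le : h => /(_ _ eta0); rewrite near_withinE => -[d /= d0 hd].
  exists d => // s Is std; have [->|st] := eqVneq s t.
    by rewrite !subrr mulr0 subr0 normr0 mulr0.
  have st0 : s - t != 0 by rewrite subr_eq0.
  have := hd s; rewrite /ball_ /= distrC => /(_ std st Is).
  rewrite distrC -(ler_pM2r (_ : 0 < `|s - t|)) ?normr_gt0// -normrM.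
  by rewrite mulrBl divfK.
apply/cvgrPdist_le => eta eta0; rewrite near_withinE.
have [d d0 hd] := h _ eta0; exists d => //= s.
rewrite /ball_ /= distrC => std st Is.
have st0 : s - t != 0 by rewrite subr_eq0.
rewrite distrC -(ler_pM2r (_ : 0 < `|s - t|)) ?normr_gt0// -normrM.
by rewrite mulrBl divfK// hd.
Qed.

Lemma has_deriv_at_subset I J f t l : J `<=` I ->
  has_deriv_at I f t l -> has_deriv_at J f t l.
Proof.
move=> JI /has_deriv_atP h; apply/has_deriv_atP => e /h[d d0 hd].
by exists d => // s /JI; exact: hd.
Qed.

Lemma eq_has_deriv_at I f g t l : I t -> {in I, f =1 g} ->
  has_deriv_at I f t l -> has_deriv_at I g t l.
Proof.
move=> It fg /has_deriv_atP h; apply/has_deriv_atP => e /h[d d0 hd].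
by exists d => // s Is; rewrite -!fg ?inE//; exact: hd.
Qed.

Lemma has_deriv_at_cst I c t : has_deriv_at I (fun=> c) t 0.
Proof.
apply/has_deriv_atP => e e0; exists 1 => // s _ _.
by rewrite subrr mul0r subr0 normr0 mulr_ge0 ?(ltW e0).
Qed.

Lemma has_deriv_at_id I t : has_deriv_at I id t 1.
Proof.
apply/has_deriv_atP => e e0; exists 1 => // s _ _.
by rewrite mul1r subrr normr0 mulr_ge0 ?(ltW e0).
Qed.

Lemma has_deriv_atD I f g t l k : has_deriv_at I f t l ->
  has_deriv_at I g t k -> has_deriv_at I (f \+ g) t (l + k).
Proof.
rewrite /has_deriv_at => hf hg; apply: cvg_trans (cvgD hf hg); apply: near_eq_cvg; apply: nearW => s.
by rewrite /= -mulrDl; congr (_ / _); rewrite opprD addrACA.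
Qed.

Lemma has_deriv_atM I f g t l k : has_deriv_at I f t l ->
  has_deriv_at I g t k -> has_deriv_at I (f \* g) t (l * g t + f t * k).
Proof.
rewrite /has_deriv_at => hf hg.
have h0 : (fun s => s - t) @ within I t^' --> (0 : R).
  apply/cvgrPdist_le => e e0; rewrite near_withinE; exists e => //= s.
  by rewrite /ball_ /= distrC sub0r normrN => /ltW.
have hne : \forall s \near within I t^', s != t.
  by rewrite near_withinE; exists 1 => //=.
have hlim := cvgD (cvgD (cvgM hf (cvgM hg h0)) (cvgM hf (cvg_cst (g t))))
   (cvgM (cvg_cst (f t)) hg).
rewrite mulr0 mulr0 add0r in hlim.
have FF : Filter (within I t^') by exact: within_filter.
apply: (cvg_trans _ (hlim FF FF FF FF FF FF FF FF)); apply: near_eq_cvg; move: hne; apply: filterS => s st.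
by rewrite !fctE /=; field; rewrite subr_eq0.
Qed.

Lemma has_deriv_atZ I f t l c : has_deriv_at I f t l ->
  has_deriv_at I (fun s => c * f s) t (c * l).
Proof.
move=> h; have := has_deriv_atM (has_deriv_at_cst I c t) h.
by rewrite mul0r add0r.
Qed.

Lemma has_deriv_atN I f t l : has_deriv_at I f t l ->
  has_deriv_at I (fun s => - f s) t (- l).
Proof.
move=> /(has_deriv_atZ (c := -1)); rewrite mulN1r.
by rewrite (_ : (fun s => -1 * f s) = (fun s => - f s))//; apply/funext => s; rewrite mulN1r.
Qed.

Lemma has_deriv_atB I f g t l k : has_deriv_at I f t l ->
  has_deriv_at I g t k -> has_deriv_at I (f \- g) t (l - k).
Proof. by move=> hf /has_deriv_atN; exact: has_deriv_atD. Qed.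

Lemma has_deriv_at_sqr I f t l : has_deriv_at I f t l ->
  has_deriv_at I (fun s => f s ^+ 2) t (2 * f t * l).
Proof.
move=> h; have := has_deriv_atM h h.
rewrite (_ : (f \* f) = (fun s => f s ^+ 2)) //.
by rewrite (_ : l * f t + f t * l = 2 * f t * l) //; ring.
Qed.

Lemma has_deriv_at_sum I (F : nat -> R -> R) (F' : nat -> R) t n :
  (forall k, has_deriv_at I (F k) t (F' k)) ->
  has_deriv_at I (fun s => \sum_(k < n) F k s) t (\sum_(k < n) F' k).
Proof.
move=> h; elim: n => [|n IH].
  rewrite big_ord0 (_ : (fun s => _) = fun=> 0); first exact: has_deriv_at_cst.
  by apply/funext => s; rewrite big_ord0.
rewrite big_ord_recr /= (_ : (fun s => _) =
    (fun s => \sum_(k < n) F k s) \+ F n).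
  exact: has_deriv_atD.
by apply/funext => s; rewrite big_ord_recr.
Qed.

End Calculus.

(** * A comparison principle *)

Section Barrier.
Context {R : realType}.
Implicit Types (I : set R) (f g G : R -> R) (t l a b : R).

Definition cont_at I f t := f @ within I (nbhs t) --> f t.

Lemma cont_atP I f t : cont_at I f t <->
  forall eta, 0 < eta -> exists2 d, 0 < d &
    forall s, I s -> `|s - t| < d -> `|f s - f t| <= eta.
Proof.
split=> [/cvgrPdist_le h eta /h|h].
  rewrite near_withinE => -[d /= d0 hd].
  exists d => // s Is std; rewrite distrC; apply: hd => //.
  by rewrite /ball_ /= distrC.
apply/cvgrPdist_le => eta /h[d d0 hd]; rewrite near_withinE; exists d => //= s.
by rewrite /ball_ /= distrC => std Is; rewrite distrC hd.
Qed.

Lemma cont_at_subset I J f t : J `<=` I -> cont_at I f t -> cont_at J f t.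
Proof.
move=> JI /cont_atP h; apply/cont_atP => e /h[d d0 hd].
by exists d => // s /JI; exact: hd.
Qed.

Lemma has_deriv_at_cont I f t l : has_deriv_at I f t l -> cont_at I f t.
Proof.
move=> /has_deriv_atP/(_ 1 ltr01)[d d0 hd]; apply/cont_atP => e e0.
exists (Num.min d (e / (`|l| + 1))); first by rewrite lt_min d0 divr_gt0.
move=> s Is; rewrite lt_min => /andP[/(hd _ Is)]; rewrite mul1r => h h2.
rewrite -(subrK (l * (s - t)) (f s - f t)) (le_trans (ler_normD _ _))//.
rewrite ltr_pdivlMr// in h2; rewrite normrM; lra.
Qed.

Lemma has_deriv_at_slope I f t l : has_deriv_at I f t l ->
  forall eta, 0 < eta -> exists2 d, 0 < d &
    forall s, I s -> t < s -> s < t + d -> f s <= f t + (l + eta) * (s - t).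
Proof.
move=> /has_deriv_atP h eta /h[d d0 hd]; exists d => // s Is ts std.
have st : 0 < s - t by rewrite subr_gt0.
have := hd s Is; rewrite gtr0_norm// ltrBlDl => /(_ std).
rewrite ler_norml => /andP[_]; lra.
Qed.

(** A form of the Gronwall lemma for functions that are not differentiable: the
    right slopes of G are at most K * G up to an arbitrarily small error.  It
    is what the energy of a mode with a merely Lipschitz coefficient satisfies.
    The proof compares G with Z t = eta * expR ((K + 1) * (t - a)).  At the last
    time m up to which G <= Z, the slope of G is at most
    K * Z m + Z m = (K + 1) * Z m, the slope of the tangent of Z at m; since Z
    is convex, G <= Z persists beyond m. *)
Lemma barrier a b K G : a <= b -> 0 <= K ->
  (forall t, a <= t <= b -> cont_at `[a, b] G t) ->
  (forall t, a <= t < b -> forall eta, 0 < eta -> exists2 d, 0 < d &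
    forall s, s <= b -> t < s -> s < t + d ->
      G s <= G t + (K * G t + eta) * (s - t)) ->
  G a <= 0 -> G b <= 0.
Proof.
move=> ab K0 Gc Gs Ga.
suff H eta : 0 < eta -> G b <= eta * expR ((K + 1) * (b - a)).
  rewrite leNgt; apply/negP => Gb.
  have E0 := expR_gt0 ((K + 1) * (b - a)).
  have := H (G b / expR ((K + 1) * (b - a)) / 2).
  rewrite !divr_gt0// => /(_ isT).
  rewrite mulrAC divfK ?gt_eqF//; lra.
move=> eta0; pose Z t := eta * expR ((K + 1) * (t - a)).
have Z0 t : 0 < Z t by rewrite mulr_gt0 ?expR_gt0.
have Zc : continuous Z.
  move=> t; apply: cvgM; first exact: cvg_cst.
  apply: continuous_comp; last exact: continuous_expR.
  by apply: cvgM; [exact: cvg_cst|apply: cvgB; [exact: cvg_id|exact: cvg_cst]].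
(* m is the last time up to which G <= Z; continuity gives G m <= Z m. *)
pose S := [set t | a <= t <= b /\ forall s, a <= s <= t -> G s <= Z s].
have Sa : S a.
  split=> [|s]; first by rewrite lexx.
  by rewrite -eq_le => /eqP <-; rewrite (le_trans Ga) ?ltW.
have hS : has_sup S.
  by split; [exists a|exists b => t [/andP[]]].
set m := sup S.
have am : a <= m by apply: sup_ubound => //; case: hS.
have mb : m <= b by apply: ge_sup => [|t [/andP[]//]]; exists a.
have below s : a <= s < m -> G s <= Z s.
  move=> /andP[as_ sm].
  have [t [_ tS] st] := @sup_adherent _ S (m - s) ltac:(by rewrite subr_gt0) hS.
  by apply: tS; rewrite as_ /= ltW// -(subKr m s).
have Gm : G m <= Z m.
  rewrite leNgt; apply/negP => ZG.
  have {}am : a < m.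
    rewrite lt_neqAle am andbT; apply/eqP => e.
    by move: ZG; rewrite -e ltNge (le_trans Ga) ?ltW.
  have : cont_at `[a, b] (G \- Z) m.
    apply: cvgB; first by apply: Gc; rewrite (ltW am).
    exact: cvg_within_filter (Zc m).
  move=> /cont_atP/(_ ((G m - Z m) / 2)); rewrite divr_gt0 ?subr_gt0//.
  case=> // d d0 hd.
  pose s := Num.max a (m - d / 2).
  have as_ : a <= s by rewrite le_max lexx.
  have sm : s < m by rewrite gt_max am /=; lra.
  have ds : m - d / 2 <= s by rewrite le_max lexx orbT.
  have := hd s; rewrite /= in_itv /= as_ (le_trans (ltW sm))//= => /(_ isT).
  rewrite ltr0_norm ?subr_lt0// => /(_ ltac:(lra)).
  rewrite ler_norml => /andP[+ _]; have := below s; rewrite as_ sm => /(_ isT).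
  lra.
have Sm : S m.
  split=> [|s /andP[as_]]; first by rewrite am.
  by rewrite le_eqVlt => /predU1P[->//|sm]; apply: below; rewrite as_.
have [bm|mb'] := leP b m.
  by have -> : b = m by apply/eqP; rewrite eq_le mb bm.
(* The error allowed in the slope of G at m is taken to be Z m itself. *)
have := Gs m; rewrite am mb' => /(_ isT _ (Z0 m))[d d0 hd].
pose s := Num.min b (m + d / 2).
have ms : m < s by rewrite lt_min mb' /=; lra.
suff Ss : S s by have := sup_ubound hS.2 Ss; rewrite -/m leNgt ms.
split=> [|r /andP[ar rs]].
  by rewrite (le_trans am (ltW ms)) /= ge_min lexx.
have [rm|mr] := leP r m; first by apply: Sm.2; rewrite ar.
have rb : r <= b by rewrite (le_trans rs)// ge_min lexx.
have rd : r < m + d.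
  have : r <= m + d / 2 by rewrite (le_trans rs)// ge_min lexx orbT.
  lra.
apply: le_trans (hd r rb mr rd) _.
have -> : Z r = Z m * expR ((K + 1) * (r - m)).
  by rewrite /Z -mulrA -expRD; congr (_ * expR _); ring.
have E : 1 + (K + 1) * (r - m) <= expR ((K + 1) * (r - m)).
  by apply: expR_ge1Dx.
apply: le_trans (_ : Z m * (1 + (K + 1) * (r - m)) <= _); last first.
  by rewrite ler_pM2l.
have rm0 : 0 <= r - m by rewrite subr_ge0 ltW.
have := mulr_ge0 (mulr_ge0 K0 rm0) (_ : 0 <= Z m - G m).
by rewrite subr_ge0 => /(_ Gm); lra.
Qed.

Lemma deriv_bound_le a b f f' L : a <= b ->
  (forall t, a <= t <= b -> has_deriv_at `[a, b] f t (f' t)) ->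
  (forall t, a <= t <= b -> f' t <= L) -> f b - f a <= L * (b - a).
Proof.
move=> ab hf hL; rewrite -subr_le0.
pose G s := (f s - f a) - L * (s - a).
rewrite -[X in X <= 0]/(G b); apply: (@barrier a b 0) => //.
- move=> t tab; have ft := has_deriv_at_cont (hf t tab).
  apply: cvgB; first by apply: cvgB => //; exact: cvg_cst.
  apply: cvgM; first exact: cvg_cst.
  apply: cvgB; last exact: cvg_cst.
  exact: cvg_within.
- move=> t /andP[at_ tb] e e0.
  have tab : a <= t <= b by rewrite at_ ltW.
  have [d d0 hd] := has_deriv_at_slope (hf t tab) e0.
  exists d => // s sb ts sd; have := hd s.
  rewrite /= in_itv /= sb (le_trans at_ (ltW ts)) => /(_ isT ts sd).
  have := hL t tab => h; have ts0 : 0 <= s - t by rewrite subr_ge0 ltW.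
  have := ler_wpM2r ts0 h; rewrite /G; lra.
- by rewrite /G; lra.
Qed.

Lemma deriv_bound_lip a b f f' L : (forall t, a <= t <= b -> has_deriv_at `[a, b] f t (f' t)) ->
  (forall t, a <= t <= b -> `|f' t| <= L) ->
  forall s t, a <= s <= b -> a <= t <= b -> `|f t - f s| <= L * `|t - s|.
Proof.
move=> hf hL.
suff H s t : a <= s -> s <= t -> t <= b -> `|f t - f s| <= L * (t - s).
  move=> s t /andP[? ?] /andP[? ?]; have [st|ts] := leP s t.
    by rewrite (ger0_norm (_ : 0 <= t - s)) ?subr_ge0// H.
  rewrite distrC (distrC t) (gtr0_norm (_ : 0 < s - t)) ?subr_gt0//.
  by rewrite H// ltW.
move=> as_ st tb.
have sub : `[s, t] `<=` `[a, b].
  move=> x /=; rewrite !in_itv /= => /andP[sx xt].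
  by rewrite (le_trans as_ sx) (le_trans xt tb).
have inab x : s <= x <= t -> a <= x <= b by move=> h; have := sub x; rewrite /= !in_itv /= => ->.
rewrite ler_norml; apply/andP; split; last first.
  apply: (@deriv_bound_le s t f f') => // x xst.
    by apply: has_deriv_at_subset sub _; exact/hf/inab.
  by apply: le_trans (hL x (inab _ xst)); exact: ler_norm.
suff : - f t - - f s <= L * (t - s) by lra.
apply: (@deriv_bound_le s t (fun x => - f x) (fun x => - f' x)) => // x xst.
  by apply: has_deriv_atN; apply: has_deriv_at_subset sub _; exact/hf/inab.
by apply: le_trans (hL x (inab _ xst)); rewrite -normrN; exact: ler_norm.
Qed.

End Barrier.

(** * Energy estimate for one mode *)

Section Mode.
Context {R : realType}.
Implicit Types (c f w : R -> R) (T L nu mu Q lam : R).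

(** Convexity of the exponential in the form used to feed exponentials into
    [barrier]. *)
Lemma expR_tangent mu (s t : R) :
  expR (mu * t) * (1 + mu * (s - t)) <= expR (mu * s).
Proof.
have -> : expR (mu * s) = expR (mu * t) * expR (mu * (s - t)).
  by rewrite -expRD; congr expR; ring.
by rewrite ler_pM2l ?expR_gt0// expR_ge1Dx.
Qed.

Lemma continuous_expRM mu : continuous (fun s : R => expR (mu * s)).
Proof.
move=> t; apply: (@continuous_comp _ _ _ (fun s => mu * s) expR).
  by apply: cvgM; [exact: cvg_cst|exact: cvg_id].
exact: continuous_expR.
Qed.

Lemma sub_itv0 T t : t <= T -> `[0, t] `<=` (`[0, T] : set R).
Proof.
by move=> tT s /=; rewrite !in_itv /= => /andP[-> /le_trans->].
Qed.

(** Integrating an exponential bound gains the factor 1 / mu, which makes the fixed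
    point map of the linear equation contract. *)
Lemma deriv_bound_exp T f f' B mu : 0 < mu -> 0 <= B ->
  (forall t, 0 <= t <= T -> has_deriv_at `[0, T] f t (f' t)) ->
  (forall t, 0 <= t <= T -> f' t <= B * expR (mu * t)) ->
  f 0 <= 0 -> forall t, 0 <= t <= T -> f t <= B / mu * expR (mu * t).
Proof.
move=> mu0 B0 hf hB f0 b /andP[b0 bT]; rewrite -subr_le0.
pose G s := f s - B / mu * expR (mu * s).
have sub := sub_itv0 bT.
have Bm0 : 0 <= B / mu by rewrite divr_ge0 // ltW.
rewrite -[X in X <= 0]/(G b); apply: (@barrier _ 0 b 0) => //.
- move=> t /andP[t0 tb]; apply: cvgB.
    apply: cont_at_subset sub _; apply: (has_deriv_at_cont (hf t _)).
    by rewrite t0 (le_trans tb).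
  apply: cvg_within_filter; apply: cvgM; first exact: cvg_cst.
  exact: continuous_expRM.
- move=> t /andP[t0 tb] e e0.
  have tT : 0 <= t <= T by rewrite t0 (le_trans (ltW tb)).
  have [d d0 hd] := has_deriv_at_slope (hf t tT) e0.
  exists d => // s sb ts sd; have := hd s.
  rewrite /= in_itv /= (le_trans sb bT) (le_trans t0 (ltW ts)) => /(_ isT ts sd).
  have h := hB t tT; have ts0 : 0 <= s - t by rewrite subr_ge0 ltW.
  have h1 := ler_wpM2r ts0 h.
  have := ler_wpM2l Bm0 (expR_tangent mu s t).
  have -> : B / mu * (expR (mu * t) * (1 + mu * (s - t))) =
     B / mu * expR (mu * t) + B * expR (mu * t) * (s - t).
    by field; rewrite gt_eqF.
  rewrite /G; lra.
- rewrite /G; have : 0 <= B / mu * expR (mu * 0) by rewrite mulr_ge0 ?expR_ge0.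
  lra.
Qed.

Lemma sqrM_ge0 (x y : R) : 0 <= x ^+ 2 * y ^+ 2.
Proof. by rewrite mulr_ge0 ?sqr_ge0. Qed.

(** Energy estimate for w'' + c lam^2 w = f.  As c is only Lipschitz, the energy F
    is not differentiable.  At each time t it is majorized to the right of t by
    the function Psi in which c s is replaced by c t + L * (s - t); Psi has the
    same value at t, and its derivative there is 2 w' f + L lam^2 w^2, because
    the terms in c t cancel.  The first term is split by the inequality between
    arithmetic and geometric means, with weight mu / 2, and the second one is at
    most L / nu times the energy, so [barrier] applies to
    F s - B * expR (2 * mu * s) with K = L / nu + mu / 2, which is at most
    3 / 2 * mu. *)
Lemma mode_energy_estimate T c lam w w1 f L nu mu Q : 0 < nu -> 0 <= L ->
  0 < mu -> L <= nu * mu ->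
  (forall t, 0 <= t <= T -> nu <= c t) ->
  (forall s t, 0 <= s <= T -> 0 <= t <= T -> `|c t - c s| <= L * `|t - s|) ->
  (forall t, 0 <= t <= T -> has_deriv_at `[0, T] w t (w1 t)) ->
  (forall t, 0 <= t <= T ->
     has_deriv_at `[0, T] w1 t (- (c t * lam ^+ 2 * w t) + f t)) ->
  0 <= Q ->
  (forall t, 0 <= t <= T -> f t ^+ 2 <= Q * expR (2 * mu * t)) ->
  forall t, 0 <= t <= T ->
    w1 t ^+ 2 + c t * (lam ^+ 2 * w t ^+ 2) <=
    (w1 0 ^+ 2 + c 0 * (lam ^+ 2 * w 0 ^+ 2) + 4 * Q / mu ^+ 2)
      * expR (2 * mu * t).
Proof.
move=> nu0 L0 mu0 Lmu hc cL hw hw1 Q0 hf b /andP[b0 bT].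
set B := (_ + _ / _); rewrite -subr_le0.
pose F s := w1 s ^+ 2 + c s * (lam ^+ 2 * w s ^+ 2).
pose G s := F s - B * expR (2 * mu * s).
have sub := sub_itv0 bT.
have h0T : 0 <= (0:R) <= T by rewrite lexx (le_trans b0).
have B0 : 0 <= B.
  have c0 : 0 <= c 0 by exact: le_trans (ltW nu0) (hc _ h0T).
  apply: addr_ge0; last by rewrite divr_ge0 ?sqr_ge0// mulr_ge0.
  by rewrite addr_ge0 ?sqr_ge0// mulr_ge0// sqrM_ge0.
have BQ : 4 * Q / mu ^+ 2 <= B.
  rewrite /B lerDr addr_ge0 ?sqr_ge0// mulr_ge0 ?sqrM_ge0//.
  exact: le_trans (ltW nu0) (hc _ h0T).
have K0 : 0 <= L / nu + mu / 2 by rewrite addr_ge0// divr_ge0// ltW.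
change (G b <= 0); apply: (@barrier _ 0 b (L / nu + mu / 2)) => //.
- move=> t /andP[t0 tb].
  have tT : 0 <= t <= T by rewrite t0 (le_trans tb).
  apply: (cont_at_subset sub); apply: cvgB; last first.
    apply: cvg_within_filter; apply: cvgM; first exact: cvg_cst.
    exact: continuous_expRM.
  have cw := has_deriv_at_cont (has_deriv_at_sqr (hw t tT)).
  have cw1 := has_deriv_at_cont (has_deriv_at_sqr (hw1 t tT)).
  apply: cvgD => //; apply: cvgM.
    apply/cont_atP => e e0; exists (e / (L + 1)).
      by rewrite divr_gt0// ltr_wpDl.
    move=> s; rewrite /= in_itv /= => sT; rewrite ltr_pdivlMr ?ltr_wpDl// => h.
    apply: le_trans (cL t s tT sT) _; apply: le_trans (ltW h).
    by rewrite mulrC ler_wpM2l// lerDl.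
  by apply: cvgM => //; exact: cvg_cst.
- move=> t /andP[t0 tb] e e0.
  have tT : 0 <= t <= T by rewrite t0 (le_trans (ltW tb)).
  pose Psi s := w1 s ^+ 2 + (c t + L * (s - t)) * (lam ^+ 2 * w s ^+ 2).
  have hPsi : has_deriv_at `[0, T] Psi t
      (2 * w1 t * f t + L * (lam ^+ 2 * w t ^+ 2)).
    have dw := has_deriv_atZ (c := lam ^+ 2) (has_deriv_at_sqr (hw t tT)).
    have dc : has_deriv_at `[0, T] (fun s => c t + L * (s - t)) t (0 + L * (1 - 0)).
      apply: has_deriv_atD; first exact: has_deriv_at_cst.
      apply: has_deriv_atZ; apply: has_deriv_atB; first exact: has_deriv_at_id.
      exact: has_deriv_at_cst.
    have := has_deriv_atD (has_deriv_at_sqr (hw1 t tT)) (has_deriv_atM dc dw).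
    congr (has_deriv_at _ _ _ _); rewrite /=; ring.
  have [d d0 hd] := has_deriv_at_slope hPsi e0.
  exists d => // s sb ts sd.
  have sT : 0 <= s <= T by rewrite (le_trans sb bT) (le_trans t0 (ltW ts)).
  have := hd s; rewrite /= in_itv /= sT => /(_ isT ts sd) h1.
  have ts0 : 0 <= s - t by rewrite subr_ge0 ltW.
  have h2 : F s <= Psi s.
    rewrite /F /Psi lerD2l ler_wpM2r ?sqrM_ge0//.
    have := cL t s tT sT; rewrite ler_norml (ger0_norm ts0) => /andP[_]; lra.
  have h3 := ler_wpM2l B0 (expR_tangent (2 * mu) s t).
  set E := expR (2 * mu * t) in h3.
  have E0 : 0 < E by exact: expR_gt0.
  have h4 : 2 * w1 t * f t <= mu / 2 * w1 t ^+ 2 + 2 / mu * (Q * E).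
    apply: le_trans (_ : mu / 2 * w1 t ^+ 2 + 2 / mu * f t ^+ 2 <= _).
      rewrite -subr_ge0.
      have -> : mu / 2 * w1 t ^+ 2 + 2 / mu * f t ^+ 2 - 2 * w1 t * f t =
        mu / 2 * (w1 t - 2 / mu * f t) ^+ 2.
        by field; rewrite gt_eqF.
      by rewrite mulr_ge0 ?sqr_ge0// divr_ge0// ltW.
    by rewrite lerD2l ler_wpM2l ?hf// divr_ge0// ltW.
  have h5 : L * (lam ^+ 2 * w t ^+ 2) <= L / nu * (c t * (lam ^+ 2 * w t ^+ 2)).
    have -> : L / nu * (c t * (lam ^+ 2 * w t ^+ 2)) =
       (L * (lam ^+ 2 * w t ^+ 2)) * (c t / nu) by ring.
    rewrite ler_peMr ?(mulr_ge0 L0) ?sqrM_ge0// ler_pdivlMr// mul1r.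
    exact: hc.
  have h6 : 2 / mu * (Q * E) <= mu / 2 * B * E.
    have -> : 2 / mu * (Q * E) = mu / 2 * (4 * Q / mu ^+ 2) * E.
      by field; rewrite gt_eqF.
    by rewrite ler_wpM2r ?(ltW E0)// ler_wpM2l// divr_ge0// ltW.
  have h7 : L / nu * (B * E) <= mu * (B * E).
    by rewrite ler_wpM2r ?mulr_ge0 ?(ltW E0)// ler_pdivrMr// mulrC.
  have h8 : 2 * w1 t * f t + L * (lam ^+ 2 * w t ^+ 2) - 2 * mu * B * E <=
     (L / nu + mu / 2) * G t.
    have h9 : 0 <= mu * (c t * (lam ^+ 2 * w t ^+ 2)).
      rewrite mulr_ge0 ?(ltW mu0)// mulr_ge0 ?sqrM_ge0//.
      exact: le_trans (ltW nu0) (hc _ tT).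
    have h10 : 0 <= L / nu * w1 t ^+ 2.
      by rewrite mulr_ge0 ?(sqr_ge0 (w1 t))// divr_ge0// ltW.
    rewrite /G /F -/E; move: h4 h5 h6 h7 h9 h10.
    rewrite (_ : mu / 2 * B * E = mu / 2 * (B * E)); last by ring.
    rewrite (_ : 2 * mu * B * E = 2 * mu * (B * E)); last by ring.
    generalize (B * E) (c t * (lam ^+ 2 * w t ^+ 2)) (L * (lam ^+ 2 * w t ^+ 2)).
    generalize (w1 t ^+ 2) (2 * w1 t * f t) (2 / mu * (Q * E)) (L / nu) => x1 x2 x3 x4 x5 x6 x7.
    lra.
  have h9 := ler_wpM2r ts0 h8.
  have -> : G t = Psi t - B * E by rewrite /G /F /Psi subrr mulr0 addr0.
  have {h9} : (2 * w1 t * f t + L * (lam ^+ 2 * w t ^+ 2) - 2 * mu * B * E) *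
    (s - t) <= (L / nu + mu / 2) * (Psi t - B * E) * (s - t).
    by move: h9; rewrite /G /F -/E /Psi subrr mulr0 addr0.
  rewrite /G; move: h1 h2 h3.
  generalize (F s) (Psi s) (Psi t) (expR (2 * mu * s)) => x1 x2 x3 x4.
  lra.
- rewrite /G /F mulr0 expR0 mulr1 /B.
  have : 0 <= 4 * Q / mu ^+ 2 by rewrite divr_ge0 ?sqr_ge0// mulr_ge0.
  lra.
Qed.

End Mode.

(** * Growth and perturbation of one mode *)

Section Perturbation.
Context {R : realType}.
Implicit Types (c f v : R -> R) (T L nu M mu lam D : R).

Definition admissible T nu M L c :=
  (forall t, 0 <= t <= T -> nu <= c t <= M) /\
  (forall s t, 0 <= s <= T -> 0 <= t <= T -> `|c t - c s| <= L * `|t - s|).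

Definition mode_solution T c lam v (v' : R -> R) :=
  (forall t, 0 <= t <= T -> has_deriv_at `[0, T] v t (v' t)) /\
  (forall t, 0 <= t <= T ->
     has_deriv_at `[0, T] v' t (- (c t * lam ^+ 2 * v t))).

Definition mode_energy lam v (v' : R -> R) t := v' t ^+ 2 + lam ^+ 2 * v t ^+ 2.

Lemma mode_energy_ge0 lam v v' t : 0 <= mode_energy lam v v' t.
Proof. by rewrite addr_ge0 ?sqr_ge0// sqrM_ge0. Qed.

(** The constant of all estimates for one mode.  It is independent of lam and of
    the rate mu, so that mu can be chosen after it. *)
Definition growth_const T nu M L := 4 * M / nu ^+ 2 * expR (2 * (L / nu + 1) * T).

Section Estimates.
Variables (T nu M L : R).
Hypotheses (nu0 : 0 < nu) (nu1 : nu <= 1) (M1 : 1 <= M) (L0 : 0 <= L).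
Local Notation C := (growth_const T nu M L).

Let M0 : 0 < M. Proof. exact: lt_le_trans M1. Qed.

Lemma growth_const_ge0 : 0 <= C.
Proof.
by rewrite mulr_ge0 ?expR_ge0// divr_ge0 ?sqr_ge0// mulr_ge0// ltW.
Qed.

(** The factor nu / 4 is kept because the perturbation estimate below loses
    4 / nu. *)
Lemma mode_energy_growth_sharp c lam v v' : admissible T nu M L c ->
  mode_solution T c lam v v' -> forall t, 0 <= t <= T ->
  mode_energy lam v v' t <= C * nu / 4 * mode_energy lam v v' 0.
Proof.
move=> [c1 c2] [h1 h2] t tT; have /andP[t0 tT'] := tT.
pose k := L / nu + 1.
have k0 : 0 < k by rewrite ltr_wpDl// divr_ge0// ltW.
have Lk : L <= nu * k by rewrite /k mulrDr mulr1 mulrCA divff ?gt_eqF// mulr1 lerDl ltW.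
have h0T : 0 <= (0:R) <= T by rewrite lexx (le_trans t0).
have c1' s : 0 <= s <= T -> nu <= c s by move=> /c1/andP[].
have h2' s : 0 <= s <= T ->
    has_deriv_at `[0, T] v' s (- (c s * lam ^+ 2 * v s) + (fun=> 0) s).
  by move=> /h2; rewrite addr0.
have q s : 0 <= s <= T -> (fun=> 0 : R) s ^+ 2 <= 0 * expR (2 * k * s).
  by move=> _; rewrite expr0n mul0r.
have := mode_energy_estimate nu0 L0 k0 Lk c1' c2 h1 h2' (lexx 0) q tT.
rewrite mulr0 mul0r addr0 => H.
have /andP[ct _] := c1 t tT; have /andP[_ c0] := c1 _ h0T.
have a0 := sqrM_ge0 lam (v t); have b0 := sqrM_ge0 lam (v 0).
have a1 := sqr_ge0 (v' t); have b1 := sqr_ge0 (v' 0).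
have H1 : nu * mode_energy lam v v' t <= v' t ^+ 2 + c t * (lam ^+ 2 * v t ^+ 2).
  by rewrite /mode_energy mulrDr lerD ?ler_piMl ?ler_wpM2r.
have H2 : v' 0 ^+ 2 + c 0 * (lam ^+ 2 * v 0 ^+ 2) <= M * mode_energy lam v v' 0.
  by rewrite /mode_energy mulrDr lerD ?ler_peMl ?ler_wpM2r.
have H3 : expR (2 * k * t) <= expR (2 * k * T).
  by rewrite ler_expR ler_wpM2l// mulr_ge0// ltW.
rewrite -(ler_pM2l nu0); apply: le_trans H1 _; apply: le_trans H _.
apply: le_trans (ler_pM _ _ H2 H3) _.
- rewrite addr_ge0// mulr_ge0// (le_trans (ltW nu0))//.
  by have /andP[] := c1 _ h0T.
- exact: expR_ge0.
rewrite le_eqVlt; apply/orP; left; apply/eqP.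
rewrite /growth_const -/k; field.
by rewrite gt_eqF.
Qed.

Lemma mode_energy_growth c lam v v' : admissible T nu M L c ->
  mode_solution T c lam v v' -> forall t, 0 <= t <= T ->
  mode_energy lam v v' t <= C * mode_energy lam v v' 0.
Proof.
move=> hc hv t tT; apply: le_trans (mode_energy_growth_sharp hc hv tT) _.
rewrite ler_wpM2r ?mode_energy_ge0// -mulrA ler_piMr ?growth_const_ge0//.
by rewrite ler_pdivrMr// mul1r (le_trans nu1)// ler1n.
Qed.

(** The difference of the two solutions solves the equation with coefficient c1
    and source (c2 - c1) lam^2 v2.  By the growth of v2 the square of this
    source is at most lam^2 D^2 expR (mu * t) ^+ 2 times the initial energy of
    v2. *)
Lemma mode_energy_perturbation (c1 c2 v1 v1' v2 v2' : R -> R) lam mu D :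
  admissible T nu M L c1 -> admissible T nu M L c2 ->
  mode_solution T c1 lam v1 v1' -> mode_solution T c2 lam v2 v2' ->
  0 <= D -> 0 < mu -> L <= nu * mu ->
  (forall t, 0 <= t <= T -> `|c1 t - c2 t| <= D * expR (mu * t)) ->
  forall t, 0 <= t <= T ->
  mode_energy lam (v1 \- v2) (v1' \- v2') t <=
    C * expR (mu * t) ^+ 2 * (mode_energy lam (v1 \- v2) (v1' \- v2') 0 +
      (D / mu) ^+ 2 * lam ^+ 2 * mode_energy lam v2 v2' 0).
Proof.
move=> a1 a2 s1 s2 D0 mu0 Lmu hD t tT.
have h0T : 0 <= (0:R) <= T by case/andP: tT => t0 /(le_trans t0) ->; rewrite lexx.
have EE s : expR (2 * mu * s) = expR (mu * s) ^+ 2.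
  by rewrite -expRM_natl -mulrA.
pose e2 := mode_energy lam v2 v2' 0.
pose Q := D ^+ 2 * lam ^+ 2 * (C * nu / 4 * e2).
have Q0 : 0 <= Q.
  rewrite mulr_ge0 ?sqrM_ge0// mulr_ge0 ?mode_energy_ge0// divr_ge0// mulr_ge0 ?(ltW nu0)//.
  exact: growth_const_ge0.
pose f s := (c2 s - c1 s) * lam ^+ 2 * v2 s.
have c1' s : 0 <= s <= T -> nu <= c1 s by move=> /a1.1/andP[].
have h1 s : 0 <= s <= T -> has_deriv_at `[0, T] (v1 \- v2) s ((v1' \- v2') s).
  by move=> sT; apply: has_deriv_atB; [exact: s1.1|exact: s2.1].
have h2 s : 0 <= s <= T -> has_deriv_at `[0, T] (v1' \- v2') s
    (- (c1 s * lam ^+ 2 * (v1 \- v2) s) + f s).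
  move=> sT; have := has_deriv_atB (s1.2 s sT) (s2.2 s sT).
  congr (has_deriv_at _ _ _ _); rewrite /f /=; ring.
have q s : 0 <= s <= T -> f s ^+ 2 <= Q * expR (2 * mu * s).
  move=> sT; rewrite EE /f.
  have -> : ((c2 s - c1 s) * lam ^+ 2 * v2 s) ^+ 2 =
    (c2 s - c1 s) ^+ 2 * (lam ^+ 2 * (lam ^+ 2 * v2 s ^+ 2)) by ring.
  have -> : Q * expR (mu * s) ^+ 2 =
    (D * expR (mu * s)) ^+ 2 * (lam ^+ 2 * (C * nu / 4 * e2)) by rewrite /Q; ring.
  apply: ler_pM; rewrite ?sqr_ge0//.
  + by rewrite mulr_ge0 ?sqr_ge0// sqrM_ge0.
  + rewrite -real_normK ?num_real// distrC lerXn2r ?nnegrE//; last exact: hD.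
    by rewrite mulr_ge0 ?expR_ge0.
  + rewrite ler_wpM2l ?sqr_ge0//.
    apply: le_trans (mode_energy_growth_sharp a2 s2 sT).
    by rewrite /mode_energy lerDr sqr_ge0.
have := mode_energy_estimate nu0 L0 mu0 Lmu c1' a1.2 h1 h2 Q0 q tT.
rewrite EE /= => H.
set w := v1 t - v2 t in H; set w' := v1' t - v2' t in H.
set d := mode_energy _ (v1 \- v2) _ 0.
have /andP[ct _] := a1.1 t tT; have /andP[_ c0] := a1.1 _ h0T.
have p0 := sqrM_ge0 lam w; have q0 := sqrM_ge0 lam (v1 0 - v2 0).
have p1 := sqr_ge0 w'; have q1 := sqr_ge0 (v1' 0 - v2' 0).
have H1 : nu * mode_energy lam (v1 \- v2) (v1' \- v2') t <= w' ^+ 2 + c1 t * (lam ^+ 2 * w ^+ 2).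
  by rewrite /mode_energy mulrDr lerD ?ler_piMl ?ler_wpM2r.
have H2 : (v1' 0 - v2' 0) ^+ 2 + c1 0 * (lam ^+ 2 * (v1 0 - v2 0) ^+ 2) <= M * d.
  by rewrite /d /mode_energy mulrDr lerD ?ler_peMl ?ler_wpM2r.
rewrite -(ler_pM2l nu0); apply: le_trans H1 _; apply: le_trans H _.
rewrite [X in _ <= X](_ : _ =
    (nu * C * d + 4 * Q / mu ^+ 2) * expR (mu * t) ^+ 2); last first.
  by rewrite /Q -/e2; field; rewrite gt_eqF.
rewrite ler_wpM2r ?sqr_ge0// lerD2r.
apply: le_trans H2 _; rewrite ler_wpM2r ?mode_energy_ge0//.
have -> : nu * C = M * (4 / nu * expR (2 * (L / nu + 1) * T)).
  by rewrite /growth_const; field; rewrite gt_eqF.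
rewrite ler_peMr ?(ltW M0)//.
have e1 : 1 <= expR (2 * (L / nu + 1) * T).
  rewrite -expR0 ler_expR; apply: mulr_ge0; last by case/andP: h0T.
  by rewrite mulr_ge0// addr_ge0// divr_ge0// ltW.
have : 1 <= 4 / nu by rewrite ler_pdivlMr// mul1r (le_trans nu1)// ler1n.
move=> n1; rewrite -[X in X <= _]mulr1; apply: ler_pM => //.
Qed.

Lemma mode_energyB_le (v1 v1' v2 v2' : R -> R) lam t :
  mode_energy lam (v1 \- v2) (v1' \- v2') t <=
  2 * mode_energy lam v1 v1' t + 2 * mode_energy lam v2 v2' t.
Proof.
rewrite /mode_energy /= -subr_ge0.
rewrite [X in 0 <= X](_ : _ = (v1' t + v2' t) ^+ 2 + lam ^+ 2 * (v1 t + v2 t) ^+ 2); last by ring.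
by rewrite addr_ge0 ?sqr_ge0// sqrM_ge0.
Qed.

Lemma mode_energy_le_dist (v1 v1' v2 v2' : R -> R) lam t :
  mode_energy lam v1 v1' t <=
  2 * mode_energy lam (v1 \- v2) (v1' \- v2') t + 2 * mode_energy lam v2 v2' t.
Proof.
rewrite /mode_energy /= -subr_ge0.
rewrite [X in 0 <= X](_ : _ = (v1' t - 2 * v2' t) ^+ 2 + lam ^+ 2 * (v1 t - 2 * v2 t) ^+ 2); last by ring.
by rewrite addr_ge0 ?sqr_ge0// sqrM_ge0.
Qed.

(** The perturbation estimate is good for low modes and useless for high ones, for
    which the growth estimate applied to v1 and v2 separately is used instead. *)
Lemma mode_energy_stability (c1 c2 v1 v1' v2 v2' : R -> R) lam mu D :
  admissible T nu M L c1 -> admissible T nu M L c2 ->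
  mode_solution T c1 lam v1 v1' -> mode_solution T c2 lam v2 v2' ->
  0 <= D -> 0 < mu -> L <= nu * mu ->
  (forall t, 0 <= t <= T -> `|c1 t - c2 t| <= D * expR (mu * t)) ->
  forall t, 0 <= t <= T ->
  mode_energy lam (v1 \- v2) (v1' \- v2') t <=
    6 * C * expR (mu * T) ^+ 2 * (mode_energy lam (v1 \- v2) (v1' \- v2') 0 +
      Num.min 1 ((D / mu) ^+ 2 * lam ^+ 2) * mode_energy lam v2 v2' 0).
Proof.
move=> a1 a2 s1 s2 D0 mu0 Lmu hD t tT.
have h1 := mode_energy_perturbation a1 a2 s1 s2 D0 mu0 Lmu hD tT.
have /andP[t0 tT'] := tT.
set d := mode_energy lam (v1 \- v2) _ 0 in h1 *.
set e2 := mode_energy lam v2 v2' 0 in h1 *.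
have d0 : 0 <= d by exact: mode_energy_ge0.
have e20 : 0 <= e2 by exact: mode_energy_ge0.
have C0 := growth_const_ge0.
have E1 : 1 <= expR (mu * T) ^+ 2.
  apply: exprn_ege1; rewrite -expR0 ler_expR mulr_ge0// ?(ltW mu0)//.
  exact: le_trans tT'.
have Et : expR (mu * t) ^+ 2 <= expR (mu * T) ^+ 2.
  by rewrite lerXn2r ?nnegrE ?expR_ge0// ler_expR ler_pM2l.
rewrite minEle; case: ifPn => _; last first.
  apply: le_trans h1 _; apply: ler_wpM2r.
    by rewrite addr_ge0// mulr_ge0// sqrM_ge0.
  rewrite -mulrA; apply: le_trans (_ : C * expR (mu * T) ^+ 2 <= _).
    by rewrite ler_wpM2l.
  by rewrite ler_peMl ?ler1n// (mulr_ge0 C0) ?sqr_ge0.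
rewrite mul1r; apply: le_trans (mode_energyB_le v1 v1' v2 v2' lam t) _.
have g1 := mode_energy_growth a1 s1 tT; have g2 := mode_energy_growth a2 s2 tT.
apply: le_trans (_ : 6 * C * 1 * (d + e2) <= _); last first.
  rewrite ler_wpM2r ?(addr_ge0 d0 e20)// ler_wpM2l//.
  by rewrite (mulr_ge0 _ C0).
have := ler_wpM2l C0 (mode_energy_le_dist v1 v1' v2 v2' lam 0).
rewrite -/d -/e2 -/e2 => h3; rewrite -/e2 in g2.
have Cd := mulr_ge0 C0 d0; have Ce := mulr_ge0 C0 e20.
lra.
Qed.

(** The factor lam of the perturbation estimate is compensated by estimating
    lam |v1 - v2| * lam |v1 + v2| through the inequality between arithmetic and
    geometric means, with a weight al proportional to 1 + lam.  The outcome has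
    the weight 1 + lam of the energy, and its last term carries the small factor
    D / mu. *)
Lemma mode_square_diff (c1 c2 v1 v1' v2 v2' : R -> R) lam mu D : 0 <= lam ->
  admissible T nu M L c1 -> admissible T nu M L c2 ->
  mode_solution T c1 lam v1 v1' -> mode_solution T c2 lam v2 v2' ->
  0 < D -> 0 < mu -> L <= nu * mu ->
  (forall t, 0 <= t <= T -> `|c1 t - c2 t| <= D * expR (mu * t)) ->
  forall t, 0 <= t <= T ->
  `|lam ^+ 2 * v1 t ^+ 2 - lam ^+ 2 * v2 t ^+ 2| <=
  C * expR (mu * t) * (mu / D * mode_energy lam (v1 \- v2) (v1' \- v2') 0 +
    3 / 2 * (D / mu) *
     ((1 + lam) * (mode_energy lam v1 v1' 0 + mode_energy lam v2 v2' 0))).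
Proof.
move=> lam0 a1 a2 s1 s2 D0 mu0 Lmu hD t tT.
have h1 := mode_energy_perturbation a1 a2 s1 s2 (ltW D0) mu0 Lmu hD tT.
have g1 := mode_energy_growth a1 s1 tT; have g2 := mode_energy_growth a2 s2 tT.
set d := mode_energy lam (v1 \- v2) _ 0 in h1 *.
set e2 := mode_energy lam v2 v2' 0 in h1 g2 *.
set e1 := mode_energy lam v1 v1' 0 in g1 *.
have d0 : 0 <= d by exact: mode_energy_ge0.
have e20 : 0 <= e2 by exact: mode_energy_ge0.
have e10 : 0 <= e1 by exact: mode_energy_ge0.
have C0 := growth_const_ge0.
set E := expR (mu * t) in h1 *.
have E0 : 0 < E by exact: expR_gt0.
set r := D / mu in h1 *; have r0 : 0 < r by exact: divr_gt0.
have -> : mu / D = r^-1 by rewrite invf_div.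
have h2 : lam ^+ 2 * (v1 t - v2 t) ^+ 2 <= C * E ^+ 2 * (d + r ^+ 2 * lam ^+ 2 * e2).
  by apply: le_trans h1; rewrite /mode_energy lerDr sqr_ge0.
have h3 : lam ^+ 2 * (v1 t + v2 t) ^+ 2 <= 2 * C * (e1 + e2).
  move: g1 g2; rewrite /mode_energy => g1 g2.
  have q1 := sqr_ge0 (v1' t); have q2 := sqr_ge0 (v2' t).
  have q3 := sqrM_ge0 lam (v1 t - v2 t); lra.
have l0 : 0 < 1 + lam by rewrite ltr_wpDr.
pose al := E * r * (1 + lam).
have al0 : 0 < al by exact: mulr_gt0 (mulr_gt0 E0 r0) l0.
have al20 : 0 < 2 * al by exact: mulr_gt0.
have h4 : `|lam ^+ 2 * v1 t ^+ 2 - lam ^+ 2 * v2 t ^+ 2| * (2 * al) <=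
   lam ^+ 2 * (v1 t - v2 t) ^+ 2 + al ^+ 2 * (lam ^+ 2 * (v1 t + v2 t) ^+ 2).
  rewrite -{1}(gtr0_norm al20) -normrM.
  rewrite ler_norml; apply/andP; split; rewrite -subr_ge0.
    rewrite [X in 0 <= X](_ : _ = lam ^+ 2 * ((v1 t - v2 t) + al * (v1 t + v2 t)) ^+ 2).
      exact: sqrM_ge0.
    by ring.
  rewrite [X in 0 <= X](_ : _ = lam ^+ 2 * ((v1 t - v2 t) - al * (v1 t + v2 t)) ^+ 2).
    exact: sqrM_ge0.
  by ring.
rewrite -(ler_pM2r al20).
apply: le_trans h4 _.
have h5 := ler_wpM2l (sqr_ge0 al) h3.
apply: le_trans (lerD h2 h5) _.
rewrite -subr_ge0 [X in 0 <= X](_ : _ = C * E ^+ 2 * ((1 + 2 * lam) * d +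
   r ^+ 2 * ((1 + lam) ^+ 2 * e1 + (1 + 2 * lam) * e2))); last first.
  by rewrite /al; field; rewrite gt_eqF.
have l20 : 0 <= 1 + 2 * lam by lra.
clearbody d e1 e2.
apply: mulr_ge0; first by rewrite (mulr_ge0 C0) ?sqr_ge0.
apply: addr_ge0; first exact: mulr_ge0.
apply: mulr_ge0; first exact: sqr_ge0.
by apply: addr_ge0; apply: mulr_ge0 => //; exact: sqr_ge0.
Qed.

End Estimates.
End Perturbation.

(** * Fixed points, antiderivatives and the linear equation of one mode *)

Section LinearMode.
Context {R : realType}.
Implicit Types (c f F x y W : R -> R) (T L nu M mu lam D a b : R).

Lemma expr2_inv_small (K e : R) : 0 < e -> exists n, K / 2 ^+ n <= e.
Proof.
move=> e0; exists (Num.bound (K / e)).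
rewrite ler_pdivrMr ?exprn_gt0// mulrC -ler_pdivrMr//.
by apply/ltW/upper_nthrootP.
Qed.

Lemma cauchy_geometric (u : nat -> R) (K : R) :
  (forall n m, `|u (n + m)%N - u n| <= K / 2 ^+ n) ->
  exists2 l, u @ \oo --> l & forall n, `|l - u n| <= K / 2 ^+ n.
Proof.
move=> hu; have cu : cvg (u @ \oo).
  apply: cauchy_cvg; apply: cauchy_exP => e e0.
  have [n hn] := expr2_inv_small K (divr_gt0 e0 (ltr0Sn R 1)).
  exists (u n); exists n => // m /= nm; rewrite /ball /= distrC.
  rewrite -(subnKC nm); apply: le_lt_trans (hu n (m - n)%N) _.
  by apply: le_lt_trans hn _; rewrite ltr_pdivrMr// ltr_pMr ?ltr1n.
exists (limn u) => // n; apply/ler_addgt0Pr => e e0.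
have /cvgrPdist_le/(_ _ e0)[m _ hm] : u @ \oo --> limn u by [].
have h2 := hm (m + n)%N (leq_addr _ _); have h1 := hu n m.
rewrite (addnC n) in h1.
rewrite -(subrK (u (m + n)%N) (limn u)) -addrA (le_trans (ler_normD _ _))//.
by rewrite [X in X <= _]addrC lerD.
Qed.

Lemma cvg_norm_le (u : nat -> R) l K : u @ \oo --> l ->
  (forall n, `|u n| <= K) -> `|l| <= K.
Proof.
move=> ul hu; apply/ler_addgt0Pr => e e0.
have /cvgrPdist_le/(_ _ e0)[m _ /(_ m (leqnn m)) hm] := ul.
by rewrite -(subrK (u m) l) (le_trans (ler_normD _ _))// [X in X <= _]addrC lerD.
Qed.

(** Contraction principle for the norm sup (|x t| / W t) over [0, T], stated for a
    set X closed under pointwise limits.  In both applications X is a set of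
    Lipschitz functions with a fixed constant, and W t = expR (mu * t). *)
Lemma weighted_fixpoint T W (X : set (R -> R)) (Phi : (R -> R) -> R -> R) x0 D0 :
  (forall t, 0 <= t <= T -> 0 <= W t) -> X x0 ->
  (forall x, X x -> X (Phi x)) ->
  (forall (x_ : nat -> R -> R) x, (forall n, X (x_ n)) ->
     (forall t, 0 <= t <= T -> x_ n t @[n --> \oo] --> x t) -> X x) ->
  (forall x y D, 0 < D -> X x -> X y ->
     (forall t, 0 <= t <= T -> `|x t - y t| <= D * W t) ->
     forall t, 0 <= t <= T -> `|Phi x t - Phi y t| <= D / 2 * W t) ->
  0 < D0 ->
  (forall t, 0 <= t <= T -> `|Phi x0 t - x0 t| <= D0 * W t) ->
  exists2 x, X x & forall t, 0 <= t <= T -> Phi x t = x t.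
Proof.
move=> W0 X0 XPhi Xc hPhi D00 h0.
pose x_ n := iter n Phi x0.
have Xx n : X (x_ n) by elim: n => [|n IH] //=; exact: XPhi.
have step n t : 0 <= t <= T -> `|x_ n.+1 t - x_ n t| <= D0 / 2 ^+ n * W t.
  elim: n t => [|n IH] t tT; first by rewrite expr0 divr1; exact: h0.
  have := hPhi _ _ _ (divr_gt0 D00 (exprn_gt0 n (ltr0n R 2))) (Xx n.+1) (Xx n) IH t tT.
  by rewrite exprSr invfM mulrA.
have far n m t : 0 <= t <= T -> `|x_ (n + m)%N t - x_ n t| <= 2 * D0 * W t / 2 ^+ n.
  move=> tT; elim: m n => [|m IH] n.
    rewrite addn0 subrr normr0 divr_ge0 ?exprn_ge0//.
    by rewrite mulr_ge0 ?W0// mulr_ge0// ltW.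
  rewrite -(subrK (x_ n.+1 t) (x_ (n + m.+1)%N t)) -addrA.
  apply: le_trans (ler_normD _ _) _; rewrite addnS -addSn.
  apply: le_trans (lerD (IH n.+1) (step n t tT)) _.
  rewrite exprS le_eqVlt; apply/orP; left; apply/eqP.
  by field; rewrite expf_neq0.
have lim t : exists l, 0 <= t <= T -> x_ n t @[n --> \oo] --> l /\
    forall n, `|l - x_ n t| <= 2 * D0 * W t / 2 ^+ n.
  have [tT|] := boolP (0 <= t <= T); last by exists 0.
  have [l ul hl] := @cauchy_geometric (fun n => x_ n t) (2 * D0 * W t)
    (fun n m => far n m t tT).
  by exists l.
have [x hx] := choice lim.
have Xx' : X x by apply: (Xc x_) => // t /hx[].
exists x => // t tT; apply/eqP; rewrite -subr_eq0 -normr_le0.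
apply/ler_addgt0Pr => e e0; rewrite add0r.
have [n hn] := expr2_inv_small (2 * D0 * W t) e0; apply: le_trans hn.
rewrite -(subrK (x_ n.+1 t) (Phi x t)) -addrA.
apply: le_trans (ler_normD _ _) _.
have hx' s : 0 <= s <= T -> `|x s - x_ n s| <= 2 * D0 / 2 ^+ n * W s.
  by move=> sT; rewrite mulrAC; exact: (hx s sT).2.
have D1 : 0 < 2 * D0 / 2 ^+ n by rewrite divr_gt0 ?exprn_gt0// mulr_gt0.
have h1 := hPhi _ _ _ D1 Xx' (Xx n) hx' t tT.
have h2 := (hx t tT).2 n.+1; rewrite distrC in h2.
apply: le_trans (lerD h1 h2) _.
rewrite exprS le_eqVlt; apply/orP; left; apply/eqP.
by field; rewrite expf_neq0.
Qed.

Definition clamp T (t : R) := Num.max 0 (Num.min T t).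

Lemma clampP T t : 0 <= T -> 0 <= clamp T t <= T.
Proof.
by move=> T0; rewrite /clamp le_max lexx /= ge_max T0 ge_min lexx.
Qed.

Lemma clamp_id T t : 0 <= t <= T -> clamp T t = t.
Proof.
by move=> /andP[t0 tT]; rewrite /clamp (min_idPr _)// (max_idPr _).
Qed.

Lemma clamp_lip T s t : `|clamp T s - clamp T t| <= `|s - t|.
Proof.
rewrite /clamp !minEle !maxEle.
repeat case: ifPn; rewrite -?ltNge; move=> *;
  (rewrite ?subrr ?normr0 ?normr_ge0//;
   rewrite ler_norml; have := ler_norm (s - t); have := ler_norm (t - s);
   rewrite (distrC t); lra).
Qed.

(** The function is extended to all reals by composition with the retraction onto
    [0, T], and integrated from -1, so that 0 becomes an interior point. *)
Lemma antiderivative_exists T f : 0 <= T ->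
  (forall t, 0 <= t <= T -> cont_at `[0, T] f t) ->
  exists2 F, F 0 = 0 & forall t, 0 <= t <= T -> has_deriv_at `[0, T] F t (f t).
Proof.
move=> T0 fc.
pose g : R -> R := f \o clamp T.
have gc : continuous g.
  move=> t; apply/cvgrPdist_le => e e0.
  have /cont_atP/(_ e e0)[d d0 hd] := fc _ (clampP t T0).
  exists d => // s; rewrite /ball_ /= distrC => std; rewrite distrC.
  apply: hd; first by rewrite /= in_itv /=; exact: clampP.
  exact: le_lt_trans (clamp_lip _ _ _) std.
pose F0 (t : R) := (\int[lebesgue_measure]_(s in `[(-1)%R, t]) g s)%R.
exists (fun t => F0 t - F0 0); first by rewrite subrr.
move=> t tT; rewrite -[f t](_ : g t - 0 = _); last first.
  by rewrite subr0 /g /= clamp_id.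
apply: has_deriv_atB; last exact: has_deriv_at_cst.
have /andP[t0 _] := tT.
have tt1 : t < t + 1 by rewrite ltrDl.
have gi : lebesgue_measure.-integrable `[-1, t + 1] (EFin \o g).
  apply: continuous_compact_integrable; first exact: segment_compact.
  exact: continuous_subspaceT.
have t1 : -1 < t by rewrite (lt_le_trans _ t0)// ltrN10.
have [dF F't] := continuous_FTC1_closed tt1 gi t1 (gc t).
rewrite -/F0 in dF F't.
have : h^-1 *: (F0 (h + t) - F0 t) @[h --> 0^'] --> g t.
  rewrite -F't /derive1.
  have -> : (fun h : R => h^-1 *: (F0 (h + t) - F0 t)) =
      (fun h => h^-1 *: ((F0 \o shift t) (h *: 1) - F0 t)).
    by apply/funext => h /=; rewrite [h *: 1]mulr1.
  exact: dF.
move=> /cvgrPdist_le H; apply/has_deriv_atP => e /H[d /= d0 hd].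
exists d => // s _ std.
have [->|st] := eqVneq s t; first by rewrite !subrr mulr0 subrr normr0 mulr0.
have st0 : s - t != 0 by rewrite subr_eq0.
have := hd (s - t); rewrite /ball_ /= sub0r normrN => /(_ std st0).
rewrite subrK /GRing.scale /= distrC -(ler_pM2r (_ : 0 < `|s - t|)) ?normr_gt0//.
by rewrite -normrM mulrBl mulrAC mulVf// mul1r.
Qed.

Lemma deriv_bound_exp_abs T f (f' : R -> R) B mu : 0 < mu -> 0 <= B ->
  (forall t, 0 <= t <= T -> has_deriv_at `[0, T] f t (f' t)) ->
  (forall t, 0 <= t <= T -> `|f' t| <= B * expR (mu * t)) ->
  f 0 = 0 -> forall t, 0 <= t <= T -> `|f t| <= B / mu * expR (mu * t).
Proof.
move=> mu0 B0 hf hB f0 t tT; rewrite ler_norml; apply/andP; split.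
  rewrite lerNl; apply: (@deriv_bound_exp _ T (fun s => - f s) (fun s => - f' s)) => //.
  - by move=> s sT; apply: has_deriv_atN; exact: hf.
  - by move=> s sT; apply: le_trans (hB s sT); rewrite -normrN ler_norm.
  - by rewrite f0 oppr0.
apply: (@deriv_bound_exp _ T f f') => //; last by rewrite f0.
by move=> s sT; apply: le_trans (hB s sT); rewrite ler_norm.
Qed.

(** The initial value problem is a fixed point equation for
    x = a + P (b + P (q * x)), where P takes the antiderivative vanishing at 0
    and q = - c lam^2.  Each P gains a factor 1 / mu in the weighted norm. *)
Lemma linear_mode_exists T nu M L c lam a b : 0 <= T -> 0 < nu -> 0 <= L ->
  admissible T nu M L c ->
  exists v v', [/\ mode_solution T c lam v v', v 0 = a & v' 0 = b].
Proof.
move=> T0 nu0 L0 [c1 c2].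
have h0T : 0 <= (0:R) <= T by rewrite lexx.
have M0 : 0 <= M.
  by have /andP[h /(le_trans h)] := c1 _ h0T; exact: le_trans (ltW nu0).
pose q t := - (c t * lam ^+ 2).
pose K := M * lam ^+ 2; have K0 : 0 <= K by exact: mulr_ge0 M0 (sqr_ge0 _).
have qK t : 0 <= t <= T -> `|q t| <= K.
  move=> /c1/andP[h1 h2]; have ct := le_trans (ltW nu0) h1.
  by rewrite normrN ger0_norm ?(mulr_ge0 ct (sqr_ge0 _))// ler_wpM2r ?sqr_ge0.
(* This rate gives K / mu ^+ 2 <= 1 / 2, the contraction factor. *)
pose mu := K + 2; have mu0 : 0 < mu by rewrite ltr_wpDl.
have Kmu : K / mu ^+ 2 <= 2^-1.
  rewrite ler_pdivrMr ?exprn_gt0// /mu -subr_ge0.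
  rewrite [X in 0 <= X](_ : _ = 2^-1 * K ^+ 2 + K + 2); last by field.
  by rewrite !addr_ge0// mulr_ge0 ?sqr_ge0// invr_ge0.
(* The ball of radius r is preserved, and its elements have images with Lipschitz
   constant Lam. *)
pose r := 2 * (`|a| + `|b| / mu).
have r0 : 0 <= r.
  by apply: mulr_ge0 => //; rewrite addr_ge0// divr_ge0// ltW.
pose B := `|b| + K * r / mu.
have B0 : 0 <= B.
  exact: addr_ge0 (normr_ge0 b) (divr_ge0 (mulr_ge0 K0 r0) (ltW mu0)).
pose Lam := B * expR (mu * T).
pose W := fun t : R => expR (mu * t).
have Wge1 t : 0 <= t -> 1 <= W t.
  by move=> t0; rewrite -expR0 ler_expR mulr_ge0// ltW.
have WT t : 0 <= t <= T -> W t <= W T.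
  by move=> /andP[_ tT]; rewrite ler_expR ler_pM2l.
pose anti f := xget (fun=> 0) [set F | F 0 = 0 /\
  forall t, 0 <= t <= T -> has_deriv_at `[0, T] F t (f t)].
have antiP f : (forall t, 0 <= t <= T -> cont_at `[0, T] f t) ->
    anti f 0 = 0 /\
    forall t, 0 <= t <= T -> has_deriv_at `[0, T] (anti f) t (f t).
  move=> /(antiderivative_exists T0)[F F0 hF].
  by rewrite /anti; case: xgetP => [_ _ []//|/(_ F)]; case.
pose X := [set x : R -> R | (forall t, 0 <= t <= T -> `|x t| <= r * W t) /\
  forall s t, 0 <= s <= T -> 0 <= t <= T -> `|x t - x s| <= Lam * `|t - s|].
have lip_cont x l : 0 <= l -> (forall s t, 0 <= s <= T -> 0 <= t <= T ->
    `|x t - x s| <= l * `|t - s|) -> forall t, 0 <= t <= T -> cont_at `[0, T] x t.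
  move=> l0 hx t tT; apply/cont_atP => e e0; exists (e / (l + 1)).
    by rewrite divr_gt0// ltr_wpDl.
  move=> s; rewrite /= in_itv /= => sT; rewrite ltr_pdivlMr ?ltr_wpDl// => h.
  apply: le_trans (hx t s tT sT) _; apply: le_trans (ltW h).
  by rewrite mulrC ler_wpM2l// lerDl.
have Lam0 : 0 <= Lam by exact: mulr_ge0 B0 (expR_ge0 _).
have qxc x : X x -> forall t, 0 <= t <= T -> cont_at `[0, T] (q \* x) t.
  move=> [_ hx] t tT; apply: cvgM; last exact: lip_cont hx t tT.
  apply: cvgN; apply: cvgM; last exact: cvg_cst.
  exact: lip_cont c2 t tT.
pose y x s := b + anti (q \* x) s.
have yd x : X x -> forall t, 0 <= t <= T -> has_deriv_at `[0, T] (y x) t (q t * x t).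
  move=> Xx t tT; rewrite -[_ * _]add0r.
  by apply: has_deriv_atD; [exact: has_deriv_at_cst|apply: (antiP _ (qxc x Xx)).2].
have yc x : X x -> forall t, 0 <= t <= T -> cont_at `[0, T] (y x) t.
  by move=> Xx t tT; exact: has_deriv_at_cont (yd x Xx t tT).
pose Phi x t := a + anti (y x) t.
have Phid x : X x -> forall t, 0 <= t <= T -> has_deriv_at `[0, T] (Phi x) t (y x t).
  move=> Xx t tT; rewrite -[y x t]add0r.
  by apply: has_deriv_atD; [exact: has_deriv_at_cst|apply: (antiP _ (yc x Xx)).2].
have yb x : X x -> y x 0 = b.
  by move=> Xx; rewrite /y (antiP _ (qxc x Xx)).1 addr0.
have Phia x : X x -> Phi x 0 = a.
  by move=> Xx; rewrite /Phi (antiP _ (yc x Xx)).1 addr0.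
have y_le x : X x -> forall t, 0 <= t <= T -> `|y x t| <= B * W t.
  move=> Xx t tT.
  have /(_ t tT) : forall s, 0 <= s <= T -> `|y x s - b| <= K * r / mu * W s.
    apply: (@deriv_bound_exp_abs T _ (fun s => q s * x s - 0)) => //.
    - exact: mulr_ge0 K0 r0.
    - move=> s sT; apply: has_deriv_atB; first exact: yd.
      exact: has_deriv_at_cst.
    - by move=> s sT; rewrite subr0 normrM -mulrA ler_pM ?qK// Xx.1.
    - by rewrite yb// subrr.
  move=> h; rewrite -(subrK b (y x t)) (le_trans (ler_normD _ _))//.
  rewrite /B mulrDl addrC lerD// ler_peMr// Wge1//; by case/andP: tT.
have XPhi x : X x -> X (Phi x).
  move=> Xx; split=> [t tT|].
    have /(_ t tT) : forall s, 0 <= s <= T -> `|Phi x s - a| <= B / mu * W s.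
      apply: (@deriv_bound_exp_abs T _ (fun s => y x s - 0)) => //.
      - move=> s sT; apply: has_deriv_atB; first exact: Phid.
        exact: has_deriv_at_cst.
      - by move=> s sT; rewrite subr0 y_le.
      - by rewrite Phia// subrr.
    move=> h; rewrite -(subrK a (Phi x t)) (le_trans (ler_normD _ _))//.
    have Wt : 1 <= W t by apply: Wge1; case/andP: tT.
    have h1 : `|a| <= `|a| * W t by rewrite ler_peMr.
    apply: le_trans (lerD h h1) _; rewrite -mulrDl ler_wpM2r ?expR_ge0//.
    have -> : B / mu = `|b| / mu + r * (K / mu ^+ 2).
      by rewrite /B; field; rewrite gt_eqF.
    have rE : r / 2 = `|a| + `|b| / mu by rewrite /r mulrAC divff ?mul1r.
    by have := ler_wpM2l r0 Kmu; move: rE; clearbody r; lra.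
  move=> s t sT tT; apply: (deriv_bound_lip (Phid x Xx)) => // u uT.
  apply: le_trans (y_le x Xx u uT) _.
  by rewrite ler_wpM2l// WT.
have X0 : X (fun=> 0).
  split=> [t tT|s t _ _]; first by rewrite normr0 mulr_ge0 ?expR_ge0.
  by rewrite subrr normr0 mulr_ge0.
have Xclosed (x_ : nat -> R -> R) x : (forall n, X (x_ n)) ->
    (forall t, 0 <= t <= T -> x_ n t @[n --> \oo] --> x t) -> X x.
  move=> Xx_ hx; split=> [t tT|s t sT tT].
    by apply: (cvg_norm_le (hx t tT)) => n; exact: (Xx_ n).1.
  apply: (cvg_norm_le (u := fun n => x_ n t - x_ n s)).
    by apply: cvgB; exact: hx.
  by move=> n; exact: (Xx_ n).2.
have contr x z D : 0 < D -> X x -> X z ->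
    (forall t, 0 <= t <= T -> `|x t - z t| <= D * W t) ->
    forall t, 0 <= t <= T -> `|Phi x t - Phi z t| <= D / 2 * W t.
  move=> D0 Xx Xz hxz t tT.
  have yxz s : 0 <= s <= T -> `|y x s - y z s| <= K * D / mu * W s.
    move=> sT; apply: (@deriv_bound_exp_abs T (y x \- y z)
      (fun s => q s * x s - q s * z s)) => //.
    - by rewrite mulr_ge0// ltW.
    - by move=> u uT; apply: has_deriv_atB; exact: yd.
    - by move=> u uT; rewrite -mulrBr normrM -mulrA ler_pM ?qK// hxz.
    - by rewrite /= !yb// subrr.
  have : `|Phi x t - Phi z t| <= K * D / mu / mu * W t.
    apply: (@deriv_bound_exp_abs T (Phi x \- Phi z) (y x \- y z)) => //.
    - by rewrite divr_ge0 ?(ltW mu0)// mulr_ge0// ltW.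
    - by move=> u uT; apply: has_deriv_atB; exact: Phid.
    - by rewrite /= !Phia// subrr.
  move/le_trans; apply; rewrite ler_wpM2r ?expR_ge0//.
  rewrite [X in X <= _](_ : _ = D * (K / mu ^+ 2)); last by field; rewrite gt_eqF.
  by rewrite ler_wpM2l// ltW.
have r10 : 0 < r + 1 by rewrite ltr_wpDl.
have h0 t : 0 <= t <= T -> `|Phi (fun=> 0) t - (fun=> 0) t| <= (r + 1) * W t.
  move=> tT; rewrite subr0; apply: le_trans ((XPhi _ X0).1 t tT) _.
  by rewrite ler_wpM2r ?expR_ge0// lerDl.
have W0 t : 0 <= t <= T -> 0 <= W t by move=> _; exact: expR_ge0.
have [x Xx hx] := weighted_fixpoint W0 X0 XPhi Xclosed contr r10 h0.
exists x, (y x); split; [split=> t tT| |exact: yb].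
- apply: eq_has_deriv_at (Phid x Xx t tT) => // s.
  by rewrite inE /= in_itv /= => /hx.
- by rewrite -mulNr; exact: yd.
- by rewrite -hx// Phia.
Qed.

End LinearMode.

(** * Series of nonnegative terms *)

Section Series.
Context {R : realType}.
Implicit Types (f g h b : nat -> R) (B e : R).

Definition tsum f : R := limn (series f).

Lemma seriesE f n : series f n = \sum_(k < n) f k.
Proof. by rewrite /series /= big_mkord. Qed.

Lemma bounded_is_cvg_series f B : (forall k, 0 <= f k) ->
  (forall n, \sum_(k < n) f k <= B) -> cvgn (series f).
Proof.
move=> f0 fB; apply: nondecreasing_is_cvgn.
  by apply: nondecreasing_series => k _ _; exact: f0.
by exists B => _ [n _ <-]; rewrite seriesE.
Qed.

Lemma tsum_le f B : cvgn (series f) ->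
  (forall n, \sum_(k < n) f k <= B) -> tsum f <= B.
Proof.
by move=> cf fB; apply: limr_le => //; apply: nearW => n; rewrite seriesE.
Qed.

Lemma sum_le_tsum f n : (forall k, 0 <= f k) -> cvgn (series f) ->
  \sum_(k < n) f k <= tsum f.
Proof.
move=> f0 cf; rewrite -seriesE; apply: nondecreasing_cvgn_le => //.
by apply: nondecreasing_series => k _ _; exact: f0.
Qed.

Lemma tsum_ge0 f : (forall k, 0 <= f k) -> cvgn (series f) -> 0 <= tsum f.
Proof. by move=> f0 cf; have := sum_le_tsum 0 f0 cf; rewrite big_ord0. Qed.

Lemma tsum_dist_le f g h B : cvgn (series f) -> cvgn (series g) ->
  (forall k, `|f k - g k| <= h k) -> (forall n, \sum_(k < n) h k <= B) ->
  `|tsum f - tsum g| <= B.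
Proof.
move=> cf cg fg hB; apply: (cvg_norm_le (cvgB cf cg)) => n.
rewrite !fctE !seriesE -sumrB; apply: le_trans (hB n).
apply: le_trans (ler_norm_sum _ _ _) _.
by apply: ler_sum => k _; exact: fg.
Qed.

(** Dominated convergence for series, in the form of a bound on all partial
    sums: the tail is controlled by that of b, and the remaining finite sum tends
    to 0. *)
Lemma tannery (I : Type) (F : set_system I) (f : nat -> I -> R) b :
  Filter F -> cvgn (series b) ->
  (forall k, 0 <= b k) ->
  (\forall x \near F, forall k, `|f k x| <= b k) ->
  (forall k, f k x @[x --> F] --> 0) ->
  forall e, 0 < e -> \forall x \near F, forall n, \sum_(k < n) `|f k x| <= e.
Proof.
move=> FF cb b0 fb f0 e e0.
have e20 : 0 < e / 2 by rewrite divr_gt0.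
have /cvgrPdist_le/(_ _ e20)[N _ hN] : series b @ \oo --> tsum b by [].
have tail m : \sum_(N <= k < N + m) b k <= e / 2.
  have := hN N (leqnn N); rewrite ger0_norm ?subr_ge0 ?seriesE ?sum_le_tsum//.
  apply: le_trans; rewrite lerBrDr addrC.
  have := sum_le_tsum (N + m)%N b0 cb; apply: le_trans.
  by rewrite -!(big_mkord xpredT) [X in _ <= X](big_cat_nat (n := N))// leq_addr.
have head : (fun x => \sum_(k < N) `|f k x|) @ F --> (0 : R).
  elim: N {hN tail} => [|N IH].
    rewrite (_ : (fun x => _) = fun=> 0); first exact: cvg_cst.
    by apply/funext => x; rewrite big_ord0.
  rewrite (_ : (fun x => _) = (fun x => \sum_(k < N) `|f k x|) \+ (fun x => `|f N x|)).
    by rewrite -[X in _ --> X]addr0; apply: cvgD => //; apply/norm_cvg0P/f0.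
  by apply/funext => x; rewrite big_ord_recr.
move: head => /cvgrPdist_le/(_ _ e20) hd.
near=> x => n.
have hx : forall k, `|f k x| <= b k by near: x.
have h1 : \sum_(k < N) `|f k x| <= e / 2.
  apply: le_trans (ler_norm _) _; rewrite -normrN -sub0r.
  by near: x.
have h2 : \sum_(k < n) `|f k x| <= \sum_(k < N + n) `|f k x|.
  rewrite -!(big_mkord xpredT (fun k => `|f k x|)).
  rewrite [X in _ <= X](big_cat_nat (n := n)) ?leq_addl//= lerDl.
  by apply: sumr_ge0.
apply: le_trans h2 _.
rewrite -(big_mkord xpredT (fun k => `|f k x|)) (big_cat_nat (n := N)) ?leq_addr//=.
rewrite [e]splitr lerD// ?big_mkord//.
apply: le_trans (tail n); apply: ler_sum => k _; exact: hx.
Unshelve. all: by end_near. Qed.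

End Series.

(** * Families of modes *)

Section NonlinearModes.
Context {R : realType}.
Variables (lam : nat -> R) (m : R -> R) (nu0 : R).
Hypothesis lam0 : forall k, 0 <= lam k.
Hypothesis nu00 : 0 < nu0.
Hypothesis m_ge : forall s, 0 <= s -> nu0 <= m s.
Hypothesis m_lip : forall S, 0 <= S -> exists2 M1, 0 <= M1 &
  forall x y, 0 <= x <= S -> 0 <= y <= S -> `|m x - m y| <= M1 * `|x - y|.
Implicit Types (v p w : nat -> R -> R) (c : R -> R).

Definition modes_solution T c v v' :=
  forall k, mode_solution T c (lam k) (v k) (v' k).

(** Summed over k, these terms give the energy of the pair of functions with
    coefficients v k and v' k. *)
Definition energy_term v v' t k :=
  (1 + lam k) * mode_energy (lam k) (v k) (v' k) t.

(** Bounding all partial sums expresses convergence and the bound at once. *)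
Definition energy_le v v' t B := forall n, \sum_(k < n) energy_term v v' t k <= B.

(** The square of the norm of A^(1/2) u when the v k are the coefficients of u. *)
Definition sigma v t := tsum (fun k => lam k ^+ 2 * v k t ^+ 2).

Definition nonlinear_solution T B v v' :=
  modes_solution T (fun t => m (sigma v t)) v v' /\
  forall t, 0 <= t <= T -> energy_le v v' t B.

Definition sub_modes v w : nat -> R -> R := fun k => v k \- w k.

Lemma energy_term_ge0 v v' t k : 0 <= energy_term v v' t k.
Proof. by rewrite mulr_ge0 ?mode_energy_ge0// addr_ge0. Qed.

Lemma energy_le_ge0 v v' t B : energy_le v v' t B -> 0 <= B.
Proof. by move=> /(_ 0%N); rewrite big_ord0. Qed.

Lemma square_le_energy v v' t k :
  lam k ^+ 2 * v k t ^+ 2 <= energy_term v v' t k.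
Proof.
have h : lam k ^+ 2 * v k t ^+ 2 <= mode_energy (lam k) (v k) (v' k) t.
  by rewrite /mode_energy lerDr sqr_ge0.
apply: le_trans h _; rewrite ler_peMl ?mode_energy_ge0//.
by rewrite lerDl.
Qed.

Lemma energy_le_dist v v' w w' t B1 B2 :
  energy_le (sub_modes v w) (sub_modes v' w') t B1 -> energy_le w w' t B2 ->
  energy_le v v' t (2 * B1 + 2 * B2).
Proof.
move=> h1 h2 n.
apply: le_trans (lerD (ler_wpM2l _ (h1 n)) (ler_wpM2l _ (h2 n))) => //.
rewrite !mulr_sumr -big_split /=; apply: ler_sum => k _.
rewrite /energy_term !(mulrCA 2) -mulrDr ler_wpM2l ?addr_ge0//.
exact: mode_energy_le_dist.
Qed.

Lemma sigma_cvg v v' t B : energy_le v v' t B ->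
  cvgn (series (fun k => lam k ^+ 2 * v k t ^+ 2)).
Proof.
move=> h; apply: (@bounded_is_cvg_series _ _ B) => [k|n]; first exact: sqrM_ge0.
apply: le_trans (h n); apply: ler_sum => k _; exact: square_le_energy.
Qed.

Lemma sigma_bound v v' t B : energy_le v v' t B -> 0 <= sigma v t <= B.
Proof.
move=> h; have cv := sigma_cvg h; apply/andP; split.
  by apply: tsum_ge0 => // k; exact: sqrM_ge0.
apply: tsum_le => // n; apply: le_trans (h n); apply: ler_sum => k _.
exact: square_le_energy.
Qed.

(** The derivative of each partial sum is a sum of terms 2 lam^2 v v', each of
    which is at most lam times the energy of its mode. *)
Lemma sigma_lip T B c v v' : modes_solution T c v v' ->
  (forall t, 0 <= t <= T -> energy_le v v' t B) ->
  forall s t, 0 <= s <= T -> 0 <= t <= T ->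
    `|sigma v t - sigma v s| <= B * `|t - s|.
Proof.
move=> hv hB s t sT tT.
apply: (cvg_norm_le (cvgB (sigma_cvg (hB t tT)) (sigma_cvg (hB s sT)))) => n.
rewrite !fctE !seriesE.
pose f r := \sum_(k < n) lam k ^+ 2 * v k r ^+ 2.
pose f' r := \sum_(k < n) lam k ^+ 2 * (2 * v k r * v' k r).
rewrite -/(f t) -/(f s).
apply: (@deriv_bound_lip _ 0 T f f') => // r rT.
  apply: (@has_deriv_at_sum _ _ (fun k r => lam k ^+ 2 * v k r ^+ 2)
     (fun k => lam k ^+ 2 * (2 * v k r * v' k r))) => k.
  apply: has_deriv_atZ; apply: has_deriv_at_sqr; exact: (hv k).1.
apply: le_trans (hB r rT n); apply: le_trans (ler_norm_sum _ _ _) _.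
apply: ler_sum => k _; rewrite /energy_term /mode_energy.
have l0 := lam0 k.
have h1 : `|lam k ^+ 2 * (2 * v k r * v' k r)| <=
    lam k * (v' k r ^+ 2 + lam k ^+ 2 * v k r ^+ 2).
  have -> : lam k ^+ 2 * (2 * v k r * v' k r) =
    lam k * (2 * (lam k * v k r) * v' k r) by ring.
  rewrite normrM ger0_norm// ler_wpM2l// -exprMn ler_norml; apply/andP; split.
    rewrite -subr_ge0 [X in 0 <= X](_ : _ = (v' k r + lam k * v k r) ^+ 2) ?sqr_ge0//.
    by ring.
  rewrite -subr_ge0 [X in 0 <= X](_ : _ = (v' k r - lam k * v k r) ^+ 2) ?sqr_ge0//.
  by ring.
apply: le_trans h1 _; rewrite ler_wpM2r ?lerDr//.
exact: (mode_energy_ge0 (lam k) (v k) (v' k) r).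
Qed.

(** The bounds depend on the energy bound B and on m only, and not on the
    coefficient c for which the modes were computed. *)
Lemma coefficient_admissible T B M1 c v v' : 0 <= B -> 0 <= M1 ->
  (forall x y, 0 <= x <= B -> 0 <= y <= B -> `|m x - m y| <= M1 * `|x - y|) ->
  modes_solution T c v v' ->
  (forall t, 0 <= t <= T -> energy_le v v' t B) ->
  admissible T (Num.min nu0 1) (m 0 + M1 * B + 1) (M1 * B)
    (fun t => m (sigma v t)).
Proof.
move=> B0 M10 hm hv hB; split=> [t tT|s t sT tT].
  have sB := sigma_bound (hB t tT); have /andP[s0 s1] := sB.
  rewrite ge_min m_ge//=.
  have := hm _ 0 sB; rewrite lexx B0 => /(_ isT).
  rewrite subr0 (ger0_norm s0) => h.
  have h2 := ler_wpM2l M10 s1.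
  have := ler_norm (m (sigma v t) - m 0); lra.
apply: le_trans (hm _ _ (sigma_bound (hB t tT)) (sigma_bound (hB s sT))) _.
by rewrite -mulrA ler_wpM2l// (sigma_lip hv hB).
Qed.

Section Comparison.
Variables (T nu M L : R).
Hypotheses (nu_gt0 : 0 < nu) (nu1 : nu <= 1) (M_ge1 : 1 <= M) (L0 : 0 <= L).
Variables (c1 c2 : R -> R) (v v' w w' : nat -> R -> R) (mu D : R).
Hypotheses (a1 : admissible T nu M L c1) (a2 : admissible T nu M L c2)
  (hv : modes_solution T c1 v v') (hw : modes_solution T c2 w w')
  (D0 : 0 < D) (mu0 : 0 < mu) (Lmu : L <= nu * mu)
  (hD : forall t, 0 <= t <= T -> `|c1 t - c2 t| <= D * expR (mu * t)).
Local Notation C := (growth_const T nu M L).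

(** Sum over k of [mode_square_diff].  With equal data d = 0 this is the
    contraction estimate, since mu may be chosen large. *)
Lemma sigma_dist Y d B1 B2 t : 0 <= t <= T ->
  energy_le v v' 0 Y -> energy_le w w' 0 Y ->
  energy_le (sub_modes v w) (sub_modes v' w') 0 d ->
  energy_le v v' t B1 -> energy_le w w' t B2 ->
  `|sigma v t - sigma w t| <=
    C * expR (mu * t) * (mu / D * d + 3 * (D / mu) * Y).
Proof.
move=> tT vY wY hd hB1 hB2; have C0 : 0 <= C by exact: growth_const_ge0.
apply: (tsum_dist_le (sigma_cvg hB1) (sigma_cvg hB2)) => [k|n].
  apply: (mode_square_diff nu_gt0 nu1 M_ge1 L0 (lam0 k) a1 a2 (hv k) (hw k)
    D0 mu0 Lmu hD tT).
rewrite -mulr_sumr ler_wpM2l ?(mulr_ge0 C0) ?expR_ge0//.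
rewrite big_split /= lerD//.
  rewrite -mulr_sumr ler_wpM2l ?divr_ge0 ?(ltW D0) ?(ltW mu0)//.
  apply: le_trans (hd n); apply: ler_sum => k _.
  by rewrite /energy_term ler_peMl ?mode_energy_ge0// lerDl.
rewrite -mulr_sumr.
have -> : 3 * (D / mu) * Y = 3 / 2 * (D / mu) * (Y + Y) by field; rewrite gt_eqF.
rewrite ler_wpM2l//.
  by rewrite mulr_ge0// divr_ge0 ?(ltW D0) ?(ltW mu0).
apply: le_trans (lerD (vY n) (wY n)); rewrite -big_split /=.
by apply: ler_sum => k _; rewrite /energy_term -mulrDr.
Qed.

Lemma energy_stability d rho t : 0 <= t <= T ->
  energy_le (sub_modes v w) (sub_modes v' w') 0 d ->
  (forall n, \sum_(k < n)
     Num.min 1 ((D / mu) ^+ 2 * lam k ^+ 2) * energy_term w w' 0 k <= rho) ->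
  energy_le (sub_modes v w) (sub_modes v' w') t
    (6 * C * expR (mu * T) ^+ 2 * (d + rho)).
Proof.
move=> tT hd hrho n; have C0 : 0 <= C by exact: growth_const_ge0.
have K0 : 0 <= 6 * C * expR (mu * T) ^+ 2.
  exact: mulr_ge0 (mulr_ge0 (ler0n R 6) C0) (sqr_ge0 _).
apply: le_trans (ler_wpM2l K0 (lerD (hd n) (hrho n))).
rewrite -big_split mulr_sumr /=; apply: ler_sum => k _.
rewrite /energy_term (mulrCA (Num.min _ _)) -mulrDr mulrCA ler_wpM2l ?addr_ge0//.
exact: (mode_energy_stability nu_gt0 nu1 M_ge1 L0 a1 a2 (hv k) (hw k)
  (ltW D0) mu0 Lmu hD tT).
Qed.

End Comparison.

Lemma energy_le_same v v' w w' : (forall k, v k 0 = w k 0) ->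
  (forall k, v' k 0 = w' k 0) ->
  energy_le (sub_modes v w) (sub_modes v' w') 0 0.
Proof.
move=> h h' n; apply: sumr_le0 => k _.
by rewrite /energy_term /mode_energy /sub_modes /= h h' !subrr expr0n /= mulr0 addr0 mulr0.
Qed.

(** By dominated convergence: each factor tends to 0 with D, and the sum is
    dominated by the energy at time 0. *)
Lemma low_modes_weight_cvg0 p p' B : energy_le p p' 0 B -> forall e, 0 < e ->
  forall mu, 0 < mu -> exists2 D, 0 < D & forall n, \sum_(k < n)
     Num.min 1 ((D / mu) ^+ 2 * lam k ^+ 2) * energy_term p p' 0 k <= e.
Proof.
move=> hB e e0 mu mu0.
pose f (k : nat) (D : R) := Num.min 1 ((D / mu) ^+ 2 * lam k ^+ 2) * energy_term p p' 0 k.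
have f_ge0 k D : 0 <= f k D.
  apply: mulr_ge0; last exact: energy_term_ge0.
  by rewrite le_min ler01 sqrM_ge0.
have := @tannery R R (0 : R)^'+ f (energy_term p p' 0) _.
have cb := bounded_is_cvg_series (energy_term_ge0 p p' 0) hB.
move=> /(_ _ cb (energy_term_ge0 p p' 0)) H.
have {H} : \forall D \near (0 : R)^'+, forall n, \sum_(k < n) `|f k D| <= e.
  apply: H => //.
    apply: nearW => D k; rewrite ger0_norm//.
    by rewrite ler_piMl ?energy_term_ge0// ge_min lexx.
  move=> k.
  have g : (fun D : R => ((D / mu) ^+ 2 * lam k ^+ 2) * energy_term p p' 0 k) @ (0 : R)^'+ --> (0:R).
    apply: (@cvg_at_right_filter _ _ (fun D : R => ((D / mu) ^+ 2 * lam k ^+ 2) * energy_term p p' 0 k)).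
    rewrite -[X in _ --> X](_ : ((0 / mu) ^+ 2 * lam k ^+ 2) * energy_term p p' 0 k = 0); last first.
      by rewrite mul0r expr0n /= !mul0r.
    apply: cvgM; last exact: cvg_cst.
    apply: cvgM; last exact: cvg_cst.
    rewrite expr2; under eq_fun do rewrite expr2.
    by apply: cvgM; apply: cvgM; solve [exact: cvg_id|exact: cvg_cst].
  apply: (squeeze_cvgr _ (cvg_cst 0) g); apply: nearW => D.
  rewrite f_ge0 /f ler_wpM2r ?energy_term_ge0//.
  by rewrite ge_min lexx orbT.
move=> H; have [D [D0 HD]] := @filter_ex _ ((0 : R)^'+) _ _
  (filterI (nbhs_right_gt (0 : R)) H).
exists D => // n; apply: le_trans (HD n).
by apply: ler_sum => k _; exact: ler_norm.
Qed.

End NonlinearModes.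

(** * The nonlinear system of modes near a given solution *)

Section NonlinearStability.
Context {R : realType}.
Variables (lam : nat -> R) (m : R -> R) (nu0 : R).
Hypothesis lam0 : forall k, 0 <= lam k.
Hypothesis nu00 : 0 < nu0.
Hypothesis m_ge : forall s, 0 <= s -> nu0 <= m s.
Hypothesis m_lip : forall S, 0 <= S -> exists2 M1, 0 <= M1 &
  forall x y, 0 <= x <= S -> 0 <= y <= S -> `|m x - m y| <= M1 * `|x - y|.
Implicit Types (v p w : nat -> R -> R) (c : R -> R).

Let nu := Num.min nu0 1.
Let nu_gt0 : 0 < nu. Proof. by rewrite lt_min nu00 ltr01. Qed.
Let nu_le1 : nu <= 1. Proof. by rewrite ge_min lexx orbT. Qed.

Let m0_ge0 : 0 <= m 0.
Proof. exact: le_trans (ltW nu00) (m_ge (lexx 0)). Qed.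

(** The constants are chosen in this order: S bounds the energy of everything
    within energy distance 1 of p; it determines M1, M, L and thus C; then mu
    makes the map Phi contract; then del makes the modes with coefficient in the
    ball X close to p, which makes Phi c admissible; finally gam makes the
    influence of the data small compared to del. *)
Lemma nonlinear_modes_stability T B eta p (p' : nat -> R -> R) :
  0 <= T -> nonlinear_solution lam m T B p p' -> 0 < eta -> eta <= 1 ->
  exists2 gam, 0 < gam & forall a b : nat -> R,
    (forall n, \sum_(k < n) (1 + lam k) *
       ((b k - p' k 0) ^+ 2 + lam k ^+ 2 * (a k - p k 0) ^+ 2) <= gam) ->
  exists v v', [/\ forall k, v k 0 = a k, forall k, v' k 0 = b k,
    nonlinear_solution lam m T (2 + 2 * B) v v' &
    forall t, 0 <= t <= T ->
      energy_le lam (sub_modes v p) (sub_modes v' p') t eta].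
Proof.
move=> T0 [hp pB] eta0 eta1.
have h0T : 0 <= (0:R) <= T by rewrite lexx.
have B0 : 0 <= B := energy_le_ge0 (pB 0 h0T).
pose S := 2 + 2 * B; have S0 : 0 <= S by rewrite addr_ge0// mulr_ge0.
have BS : B <= S by rewrite /S; lra.
have pS t : 0 <= t <= T -> energy_le lam p p' t S.
  by move=> tT n; apply: le_trans (pB t tT n) BS.
have [M1 M10 hM1] := m_lip S0.
pose M := m 0 + M1 * S + 1; pose L := M1 * S.
have M1S : 0 <= M1 * S by exact: mulr_ge0.
have L0 : 0 <= L by [].
have M_ge1 : 1 <= M by rewrite /M lerDr addr_ge0.
pose C := growth_const T nu M L.
have C0 : 0 <= C by exact: growth_const_ge0.
(* 12 makes the part of the distance of Phi c to cs that is due to the distance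
   of c to cs at most del / 4. *)
pose mu := L / nu + 12 * (M1 * C * S) + 1.
have MCS0 : 0 <= M1 * C * S by exact: mulr_ge0 (mulr_ge0 M10 C0) S0.
have Lnu0 : 0 <= L / nu by rewrite divr_ge0// ltW.
have mu0 : 0 < mu by rewrite /mu ltr_wpDl// addr_ge0// mulr_ge0.
have Lmu : L <= nu * mu.
  rewrite mulrC -ler_pdivrMr//.
  by rewrite /mu; have := mulr_ge0 (ler0n R 12) MCS0; lra.
have MCSmu : M1 * C * 3 * S <= mu / 4.
  have -> : M1 * C * 3 * S = 3 * (M1 * C * S) by ring.
  by rewrite /mu; lra.
pose G := 6 * C * expR (mu * T) ^+ 2 + 1.
have G1 : 6 * C * expR (mu * T) ^+ 2 <= G by rewrite /G lerDl.
have GC0 : 0 <= 6 * C * expR (mu * T) ^+ 2.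
  exact: mulr_ge0 (mulr_ge0 (ler0n R 6) C0) (sqr_ge0 _).
have G0 : 0 < G by rewrite /G ltr_wpDl.
have rho0 : 0 < eta / (2 * G) by rewrite divr_gt0// mulr_gt0.
have [del del0 hdel] := low_modes_weight_cvg0 lam0 (pB 0 h0T) rho0 mu0.
pose K := 4 * (M1 * C * mu + 1).
have MCm0 : 0 <= M1 * C * mu by exact: mulr_ge0 (mulr_ge0 M10 C0) (ltW mu0).
have K0 : 0 < K by rewrite /K mulr_gt0// ltr_wpDl.
pose gam := Num.min 1 (Num.min (eta / (2 * G)) (del ^+ 2 / K)).
have gam0 : 0 < gam by rewrite !lt_min ltr01 rho0 divr_gt0// exprn_gt0.
have gam1 : gam <= 1 by rewrite ge_min lexx.
have gam2 : gam <= eta / (2 * G) by rewrite !ge_min lexx orbT.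
have gam3 : gam <= del ^+ 2 / K by rewrite !ge_min lexx !orbT.
exists gam => // a b hab.
pose cs t := m (sigma lam p t).
pose X := [set c : R -> R | admissible T nu M L c /\
  forall t, 0 <= t <= T -> `|c t - cs t| <= del * expR (mu * t)].
have cs_adm : admissible T nu M L cs.
  exact: (coefficient_admissible lam0 m_ge S0 M10 hM1 hp pS).
pose modes c := xget (fun=> fun=> 0 : R, fun=> fun=> 0 : R)
  [set vv : (nat -> R -> R) * (nat -> R -> R) |
    [/\ modes_solution lam T c vv.1 vv.2, forall k, vv.1 k 0 = a k &
        forall k, vv.2 k 0 = b k]].
have modesP c : admissible T nu M L c ->
    [/\ modes_solution lam T c (modes c).1 (modes c).2,
        forall k, (modes c).1 k 0 = a k & forall k, (modes c).2 k 0 = b k].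
  move=> hc; rewrite /modes; case: xgetP => [vv _ //|].
  have /choice[f hf] : forall k, exists vv : (R -> R) * (R -> R),
      [/\ mode_solution T c (lam k) vv.1 vv.2, vv.1 0 = a k & vv.2 0 = b k].
    move=> k.
    have [v [v' ?]] := linear_mode_exists (lam k) (a k) (b k) T0 nu_gt0 L0 hc.
    by exists (v, v').
  move=> /(_ (fun k => (f k).1, fun k => (f k).2)); case.
  by split=> k /=; case: (hf k).
pose V c := (modes c).1; pose V' c := (modes c).2.
have dist0 c : admissible T nu M L c ->
    energy_le lam (sub_modes (V c) p) (sub_modes (V' c) p') 0 gam.
  move=> /modesP[_ h1 h2] n; apply: le_trans (hab n).
  apply: ler_sum => k _; rewrite /energy_term /mode_energy /sub_modes /=.
  by rewrite /V /V' h1 h2.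
have V0S c : admissible T nu M L c -> energy_le lam (V c) (V' c) 0 S.
  move=> hc n; apply: le_trans (energy_le_dist lam0 (dist0 c hc) (pB 0 h0T) n) _.
  by rewrite /S; lra.
have closeV c : X c -> forall t, 0 <= t <= T ->
    energy_le lam (sub_modes (V c) p) (sub_modes (V' c) p') t eta.
  move=> [hc hd] t tT n; have [hV _ _] := modesP c hc.
  apply: le_trans (energy_stability lam0 nu_gt0 nu_le1 M_ge1 L0 hc cs_adm hV hp
    del0 mu0 Lmu hd tT (dist0 c hc) hdel n) _.
  apply: le_trans (_ : G * (eta / (2 * G) + eta / (2 * G)) <= _).
    apply: ler_pM => //; last by rewrite lerD2r.
    by rewrite addr_ge0// ltW.
  by rewrite le_eqVlt; apply/orP; left; apply/eqP; field; rewrite gt_eqF.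
have VS c : X c -> forall t, 0 <= t <= T -> energy_le lam (V c) (V' c) t S.
  move=> Xc t tT n; apply: le_trans (energy_le_dist lam0 (closeV c Xc t tT) (pB t tT) n) _.
  by rewrite /S lerD2r; lra.
pose Phi c t := m (sigma lam (V c) t).
have XPhi c : X c -> X (Phi c).
  move=> Xc; have [hc hd] := Xc; have [hV _ _] := modesP c hc.
  split; first exact: (coefficient_admissible lam0 m_ge S0 M10 hM1 hV (VS c Xc)).
  move=> t tT.
  have := hM1 _ _ (sigma_bound lam0 (VS c Xc t tT)) (sigma_bound lam0 (pS t tT)).
  move=> /le_trans; apply.
  have h := sigma_dist lam0 nu_gt0 nu_le1 M_ge1 L0 hc cs_adm hV hp del0 mu0 Lmu hd
    tT (V0S c hc) (pS 0 h0T) (dist0 c hc) (VS c Xc t tT) (pS t tT).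
  apply: le_trans (ler_wpM2l M10 h) _.
  have -> : M1 * (C * expR (mu * t) * (mu / del * gam + 3 * (del / mu) * S)) =
    (M1 * C * mu * gam / del + M1 * C * 3 * S * (del / mu)) * expR (mu * t) by ring.
  rewrite ler_wpM2r ?expR_ge0//.
  have h1 : M1 * C * mu * gam / del <= del / 4.
    rewrite ler_pdivrMr//.
    have : K / 4 * gam <= del / 4 * del.
      have -> : del / 4 * del = K / 4 * (del ^+ 2 / K) by field; rewrite gt_eqF.
      by rewrite ler_wpM2l// divr_ge0// ltW.
    apply: le_trans; rewrite ler_wpM2r ?(ltW gam0)//.
    have -> : K / 4 = M1 * C * mu + 1 by rewrite /K; field.
    by rewrite lerDl.
  have h2 : M1 * C * 3 * S * (del / mu) <= del / 4.
    have dm0 : 0 <= del / mu by rewrite divr_ge0 ?ltW.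
    apply: le_trans (ler_wpM2r dm0 MCSmu) _.
    rewrite le_eqVlt; apply/orP; left; apply/eqP; field.
    by rewrite gt_eqF.
  by apply: le_trans (lerD h1 h2) _; lra.
have Xcs : X cs.
  split=> // t tT; rewrite subrr normr0 mulr_ge0 ?expR_ge0//.
  exact: ltW.
have Xclosed (c_ : nat -> R -> R) c : (forall n, X (c_ n)) ->
    (forall t, 0 <= t <= T -> c_ n t @[n --> \oo] --> c t) -> X c.
  move=> Xc_ hc; split; first split.
  - move=> t tT; apply/andP; split.
      rewrite -[c t](cvg_lim _ (hc t tT))//; apply: limr_ge.
        by apply/cvg_ex; exists (c t); exact: hc.
      by apply: nearW => n; have [[h _] _] := Xc_ n; case/andP: (h t tT).
    rewrite -[c t](cvg_lim _ (hc t tT))//; apply: limr_le.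
      by apply/cvg_ex; exists (c t); exact: hc.
    by apply: nearW => n; have [[h _] _] := Xc_ n; case/andP: (h t tT).
  - move=> s t sT tT.
    apply: (cvg_norm_le (cvgB (hc t tT) (hc s sT))) => n.
    by have [[_ h] _] := Xc_ n; exact: h.
  - move=> t tT; apply: (cvg_norm_le (cvgB (hc t tT) (cvg_cst (cs t)))) => n.
    by have [_ h] := Xc_ n; exact: h.
have contr c1 c2 D : 0 < D -> X c1 -> X c2 ->
    (forall t, 0 <= t <= T -> `|c1 t - c2 t| <= D * expR (mu * t)) ->
    forall t, 0 <= t <= T -> `|Phi c1 t - Phi c2 t| <= D / 2 * expR (mu * t).
  move=> D0 X1 X2 hd t tT; have [hc1 _] := X1; have [hc2 _] := X2.
  have [hV1 a1 b1] := modesP c1 hc1; have [hV2 a2 b2] := modesP c2 hc2.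
  have := hM1 _ _ (sigma_bound lam0 (VS _ X1 t tT)) (sigma_bound lam0 (VS _ X2 t tT)).
  move=> /le_trans; apply.
  have same : energy_le lam (sub_modes (V c1) (V c2)) (sub_modes (V' c1) (V' c2)) 0 0.
    by apply: energy_le_same => k; rewrite /V /V' ?a1 ?a2 ?b1 ?b2.
  have h := sigma_dist lam0 nu_gt0 nu_le1 M_ge1 L0 hc1 hc2 hV1 hV2 D0 mu0 Lmu hd
    tT (V0S _ hc1) (V0S _ hc2) same (VS _ X1 t tT) (VS _ X2 t tT).
  apply: le_trans (ler_wpM2l M10 h) _.
  have -> : M1 * (C * expR (mu * t) * (mu / D * 0 + 3 * (D / mu) * S)) =
    (M1 * C * 3 * S * (D / mu)) * expR (mu * t) by ring.
  rewrite ler_wpM2r ?expR_ge0//.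
  have dm0 : 0 <= D / mu by rewrite divr_ge0 ?ltW.
  apply: le_trans (ler_wpM2r dm0 MCSmu) _.
  have -> : mu / 4 * (D / mu) = D / 4 by field; rewrite gt_eqF.
  lra.
have W0 t : 0 <= t <= T -> 0 <= expR (mu * t) by move=> _; exact: expR_ge0.
have init t : 0 <= t <= T -> `|Phi cs t - cs t| <= del * expR (mu * t).
  by move=> tT; have [_ h] := XPhi _ Xcs; exact: h.
have [c Xc hc] := weighted_fixpoint W0 Xcs XPhi Xclosed contr del0 init.
have [hV Va Vb] := modesP c Xc.1.
exists (V c), (V' c); split=> //; last exact: closeV.
split=> [k|]; last exact: VS.
have [h1 h2] := hV k; split=> // t tT.
by rewrite -/(Phi c t) hc//; exact: h2.
Qed.

(** Each application of [sigma_dist] with equal data halves the bound on the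
    distance of the two coefficients in the weighted norm. *)
Lemma nonlinear_coefficient_unique T S v (v' : nat -> R -> R) w (w' : nat -> R -> R) :
  0 <= T -> nonlinear_solution lam m T S v v' -> nonlinear_solution lam m T S w w' ->
  (forall k, v k 0 = w k 0) -> (forall k, v' k 0 = w' k 0) ->
  forall t, 0 <= t <= T -> m (sigma lam v t) = m (sigma lam w t).
Proof.
move=> T0 [hv vS] [hw wS] e0 e1.
have h0T : 0 <= (0:R) <= T by rewrite lexx.
have S0 : 0 <= S := energy_le_ge0 (vS 0 h0T).
have [M1 M10 hM1] := m_lip S0.
pose M := m 0 + M1 * S + 1; pose L := M1 * S.
have M1S : 0 <= M1 * S by exact: mulr_ge0.
have L0 : 0 <= L by [].
have M_ge1 : 1 <= M by rewrite /M lerDr addr_ge0.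
pose C := growth_const T nu M L.
have C0 : 0 <= C by exact: growth_const_ge0.
pose mu := L / nu + 6 * (M1 * C * S) + 1.
have MCS0 : 0 <= M1 * C * S by exact: mulr_ge0 (mulr_ge0 M10 C0) S0.
have Lnu0 : 0 <= L / nu by rewrite divr_ge0// ltW.
have mu0 : 0 < mu by rewrite /mu ltr_wpDl// addr_ge0// mulr_ge0.
have Lmu : L <= nu * mu.
  rewrite mulrC -ler_pdivrMr//.
  by rewrite /mu; have := mulr_ge0 (ler0n R 6) MCS0; lra.
have MCSmu : M1 * C * 3 * S <= mu / 2.
  have -> : M1 * C * 3 * S = 3 * (M1 * C * S) by ring.
  by rewrite /mu; lra.
pose c1 t := m (sigma lam v t); pose c2 t := m (sigma lam w t).
have a1 : admissible T nu M L c1.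
  exact: (coefficient_admissible lam0 m_ge S0 M10 hM1 hv vS).
have a2 : admissible T nu M L c2.
  exact: (coefficient_admissible lam0 m_ge S0 M10 hM1 hw wS).
have same := energy_le_same lam e0 e1.
have M0 : 0 < M by exact: lt_le_trans M_ge1.
have main n t : 0 <= t <= T -> `|c1 t - c2 t| <= M / 2 ^+ n * expR (mu * t).
  elim: n t => [|n IH] t tT.
    rewrite expr0 divr1; apply: le_trans (_ : M * 1 <= _).
      have /andP[l1 u1] := a1.1 t tT; have /andP[l2 u2] := a2.1 t tT.
      by have := nu_gt0; rewrite mulr1 ler_norml => ?; apply/andP; split; lra.
    rewrite ler_wpM2l ?(ltW M0)// -expR0 ler_expR mulr_ge0 ?(ltW mu0)//.
    by case/andP: tT.
  pose D := M / 2 ^+ n; have D0 : 0 < D by rewrite divr_gt0// exprn_gt0.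
  have h := sigma_dist lam0 nu_gt0 nu_le1 M_ge1 L0 a1 a2 hv hw D0 mu0 Lmu IH
    tT (vS 0 h0T) (wS 0 h0T) same (vS t tT) (wS t tT).
  apply: le_trans (hM1 _ _ (sigma_bound lam0 (vS t tT)) (sigma_bound lam0 (wS t tT))) _.
  apply: le_trans (ler_wpM2l M10 h) _.
  have -> : M1 * (C * expR (mu * t) * (mu / D * 0 + 3 * (D / mu) * S)) =
    (M1 * C * 3 * S * (D / mu)) * expR (mu * t) by ring.
  rewrite ler_wpM2r ?expR_ge0//.
  have dm0 : 0 <= D / mu by rewrite divr_ge0 ?ltW.
  apply: le_trans (ler_wpM2r dm0 MCSmu) _.
  rewrite le_eqVlt; apply/orP; left; apply/eqP.
  by rewrite exprS /D; field; rewrite expf_neq0// gt_eqF.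
move=> t tT; apply/eqP; rewrite -subr_eq0 -normr_le0.
apply/ler_addgt0Pr => e e_gt0; rewrite add0r.
have [n hn] := expr2_inv_small (M * expR (mu * t)) e_gt0.
apply: le_trans (main n t tT) _; apply: le_trans hn.
by rewrite mulrAC.
Qed.

(** By uniqueness the coefficients of v and w agree, hence so do v' and w', as well
    as lam v and lam w; the energy of the distance to p only sees these. *)
Lemma nonlinear_solution_close T B S eta v (v' : nat -> R -> R) w (w' : nat -> R -> R)
    p (p' : nat -> R -> R) :
  0 <= T -> nonlinear_solution lam m T B v v' -> nonlinear_solution lam m T S w w' ->
  (forall k, v k 0 = w k 0) -> (forall k, v' k 0 = w' k 0) ->
  (forall t, 0 <= t <= T ->
      energy_le lam (sub_modes v p) (sub_modes v' p') t eta) ->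
  forall t, 0 <= t <= T ->
      energy_le lam (sub_modes w p) (sub_modes w' p') t eta.
Proof.
move=> T0 hv hw e0 e1 close t tT n.
pose Q := Num.max B S.
have vQ : nonlinear_solution lam m T Q v v'.
  split=> [|s sT j]; first exact: hv.1.
  by apply: le_trans (hv.2 s sT j) _; rewrite le_max lexx.
have wQ : nonlinear_solution lam m T Q w w'.
  split=> [|s sT j]; first exact: hw.1.
  by apply: le_trans (hw.2 s sT j) _; rewrite le_max lexx orbT.
have eqc := nonlinear_coefficient_unique T0 vQ wQ e0 e1.
have h0T : 0 <= (0:R) <= T by rewrite lexx.
have Q0 : 0 <= Q := energy_le_ge0 (vQ.2 0 h0T).
have [M1 M10 hM1] := m_lip Q0.
have a1 := coefficient_admissible lam0 m_ge Q0 M10 hM1 vQ.1 vQ.2.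
have a2 := coefficient_admissible lam0 m_ge Q0 M10 hM1 wQ.1 wQ.2.
set L := M1 * Q in a1 a2; set M := m 0 + L + 1 in a1 a2.
have L0 : 0 <= L by exact: mulr_ge0.
have M_ge1 : 1 <= M by rewrite /M lerDr addr_ge0.
pose mu := L / nu + 1.
have mu0 : 0 < mu by rewrite /mu ltr_wpDl// divr_ge0// ltW.
have Lmu : L <= nu * mu by rewrite mulrC -ler_pdivrMr// /mu lerDl.
have hd s : 0 <= s <= T -> `|m (sigma lam v s) - m (sigma lam w s)| <= 0 * expR (mu * s).
  by move=> sT; rewrite eqc// subrr normr0 mul0r.
apply: le_trans (close t tT n); apply: ler_sum => k _.
rewrite /energy_term ler_wpM2l ?addr_ge0//.
have := mode_energy_perturbation nu_gt0 nu_le1 M_ge1 L0 a1 a2 (vQ.1 k) (wQ.1 k)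
  (lexx 0) mu0 Lmu hd tT.
rewrite mul0r expr0n /= !mul0r addr0.
have -> : mode_energy (lam k) (v k \- w k) (v' k \- w' k) 0 = 0.
  by rewrite /mode_energy /= e0 e1 !subrr expr0n /= mulr0 addr0.
rewrite mulr0 /mode_energy /= => hle.
have h1 := sqr_ge0 (v' k t - w' k t); have h2 := sqrM_ge0 (lam k) (v k t - w k t).
have E1 : v' k t - w' k t = 0.
  by apply/eqP; rewrite -sqrf_eq0 eq_le h1 andbT; lra.
have E2 : lam k * (v k t - w k t) = 0.
  by apply/eqP; rewrite -sqrf_eq0 exprMn eq_le h2 andbT; lra.
rewrite /mode_energy /sub_modes /=.
have -> : w' k t - p' k t = v' k t - p' k t - (v' k t - w' k t) by ring.
rewrite E1 subr0 -!exprMn.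
have -> : lam k * (w k t - p k t) =
  lam k * (v k t - p k t) - lam k * (v k t - w k t) by ring.
by rewrite E2 subr0.
Qed.

End NonlinearStability.

(** * Expansions in an orthonormal basis *)

Section Hilbert.
Context {R : realType} {H : completeNormedModType R}.
Variables (dot : {dot H for idfun}) (e : nat -> H).
Hypotheses (hdot : norm_from_dot dot) (he : orthonormal_basis dot e).
Implicit Types (x y z : H) (a b : nat -> R).

Lemma dotC x y : dot x y = dot y x.
Proof. by rewrite hermC expr0 mul1r. Qed.

Lemma normsq_sum (r : seq nat) a : uniq r ->
  `|\sum_(k <- r) a k *: e k| ^+ 2 = \sum_(k <- r) a k ^+ 2.
Proof.
have dot_sum (s : seq nat) j : j \notin s -> dot (\sum_(k <- s) a k *: e k) (e j) = 0.
  elim: s => [|k s IH]; first by rewrite big_nil linear0l.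
  rewrite inE negb_or big_cons => /andP[jk /IH {}IH].
  by rewrite linearDl linearZl_LR /= IH he.1 eq_sym (negbTE jk) mulr0 addr0.
elim: r => [|k r IH] /=; first by rewrite !big_nil normr0 expr0n.
move=> /andP[kr /IH {}IH]; rewrite !big_cons -IH !hdot.
rewrite linearDl !linearDr /= [dot (a k *: e k) (\sum_(_ <- _) _)]dotC.
rewrite !linearZl_LR !linearZr_LR /= dot_sum// he.1 eqxx.
by rewrite !mulr0 addr0 add0r mulr1 expr2.
Qed.

Lemma normsq_series a n : `|series (fun k => a k *: e k) n| ^+ 2 = \sum_(k < n) a k ^+ 2.
Proof.
by rewrite /series /= normsq_sum ?iota_uniq// big_mkord.
Qed.

Lemma dot_series a n j : (j < n)%N ->
  dot (series (fun k => a k *: e k) n) (e j) = a j.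
Proof.
move=> jn; rewrite seriesEord /= linear_sumlz /= (bigD1 (Ordinal jn))//=.
rewrite linearZl_LR /= he.1 eqxx mulr1 big1 ?addr0// => i ij.
rewrite linearZl_LR /= he.1; case: eqP => [E|_]; last by rewrite mulr0.
by case/eqP: ij; apply/val_inj.
Qed.

(** Bessel inequality for one basis vector, obtained from the square of the norm
    of x - dot x (e j) *: e j. *)
Lemma dot_basis_le x j : `|dot x (e j)| <= `|x|.
Proof.
rewrite -ler_sqr ?nnegrE// real_normK ?num_real//.
have := sqr_ge0 `|x - dot x (e j) *: e j|.
rewrite hdot linearBl !linearBr /= !linearZl_LR !linearZr_LR /= [dot (e j) x]dotC.
by rewrite he.1 eqxx hdot [_ *: (_ * _)]/GRing.scale /= mulr1 subrr subr0 subr_ge0 expr2.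
Qed.

Lemma dot_series_lim a z : series (fun k => a k *: e k) @ \oo --> z ->
  forall j, dot z (e j) = a j.
Proof.
move=> hz j; apply/eqP; rewrite -subr_eq0 -normr_le0.
apply/ler_addgt0Pr => eps eps0; rewrite add0r.
have /cvgrPdist_le/(_ _ eps0)[N _ hN] := hz.
have := hN (maxn N j.+1) (leq_maxl _ _); apply: le_trans.
rewrite -(dot_series a (leq_maxr N j.+1)) -linearBl.
exact: dot_basis_le.
Qed.

Lemma normsq_series_cvg a z : series (fun k => a k *: e k) @ \oo --> z ->
  series (fun k => a k ^+ 2) @ \oo --> `|z| ^+ 2.
Proof.
move=> hz.
have -> : series (fun k => a k ^+ 2) =
    (fun n => `|series (fun k => a k *: e k) n| * `|series (fun k => a k *: e k) n|).
  by apply/funext => n; rewrite -expr2 normsq_series seriesE.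
by rewrite expr2; apply: cvgM; apply: cvg_norm.
Qed.

Lemma parseval x : series (fun k => dot x (e k) ^+ 2) @ \oo --> `|x| ^+ 2.
Proof. by apply: normsq_series_cvg; exact: he.2. Qed.

Lemma basis_inj x y : (forall k, dot x (e k) = dot y (e k)) -> x = y.
Proof.
move=> h; apply/eqP; rewrite -subr_eq0 -normr_eq0 -sqrf_eq0; apply/eqP.
apply: (cvg_unique _ (@parseval (x - y))) => //.
rewrite (_ : (fun k => _) = (fun=> 0)); last first.
  by apply/funext => k; rewrite linearBl /= h subrr expr0n.
rewrite (_ : series _ = fun=> 0); first exact: cvg_cst.
by apply/funext => n; rewrite seriesE big1.
Qed.

Lemma riesz_fischer a : cvgn (series (fun k => a k ^+ 2)) ->
  cvgn (series (fun k => a k *: e k)).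
Proof.
move=> /cvg_cauchy/cauchy_seriesP ha; apply: cauchy_cvg; apply/cauchy_seriesP.
move=> eps eps0; have := ha _ (exprn_gt0 2 eps0); apply: filterS => -[n1 n2] /=.
rewrite -(normsq_sum _ (iota_uniq _ _)) normrX normr_id.
by rewrite ltr_sqr ?nnegrE// ltW.
Qed.

Variable lam : nat -> R.
Hypothesis lam0 : forall k, 0 <= lam k.

Lemma powR4 (al : R) k : lam k `^ (4 * al) = (lam k `^ (2 * al)) ^+ 2.
Proof.
by rewrite -powR_mulrn ?powR_ge0// -powRrM; congr (_ `^ _); ring.
Qed.

Lemma powR4E (al : R) (n : nat) k : 4 * al = n%:R -> lam k `^ (4 * al) = lam k ^+ n.
Proof. by move=> ->; rewrite powR_mulrn. Qed.

Lemma op_pow_normsq (al : R) z : dom_pow dot e lam al z ->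
  series (fun k => lam k `^ (4 * al) * dot z (e k) ^+ 2) @ \oo -->
    `|op_pow dot e lam al z| ^+ 2.
Proof.
have -> : (fun k => lam k `^ (4 * al) * dot z (e k) ^+ 2) =
    (fun k => (lam k `^ (2 * al) * dot z (e k)) ^+ 2).
  by apply/funext => k; rewrite exprMn powR4.
rewrite /dom_pow /= => hz; apply: normsq_series_cvg.
apply: riesz_fischer; move: hz.
by congr (cvgn (series _)); apply/funext => k; rewrite exprMn powR4.
Qed.

Lemma graph_norm_ge0 (al : R) z : 0 <= graph_norm dot e lam al z.
Proof. exact: sqrtr_ge0. Qed.

Lemma graph_norm_sqr (al : R) z : graph_norm dot e lam al z ^+ 2 =
  `|z| ^+ 2 + `|op_pow dot e lam al z| ^+ 2.
Proof. by rewrite sqr_sqrtr// addr_ge0// sqr_ge0. Qed.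

Lemma graph_norm_cvg (al : R) z : dom_pow dot e lam al z ->
  series (fun k => (1 + lam k `^ (4 * al)) * dot z (e k) ^+ 2) @ \oo -->
    graph_norm dot e lam al z ^+ 2.
Proof.
move=> hz; rewrite graph_norm_sqr.
rewrite (_ : series _ = series (fun k => dot z (e k) ^+ 2) +
    series (fun k => lam k `^ (4 * al) * dot z (e k) ^+ 2)).
  by apply: cvgD; [exact: parseval|exact: op_pow_normsq].
by rewrite -seriesD; congr series; apply/funext => k; rewrite fctE [LHS]mulrDl mul1r.
Qed.

Lemma graph_term_ge0 (al : R) z k : 0 <= (1 + lam k `^ (4 * al)) * dot z (e k) ^+ 2.
Proof. by rewrite mulr_ge0 ?sqr_ge0// addr_ge0 ?powR_ge0. Qed.

Lemma sum_le_graph_norm (al : R) z n : dom_pow dot e lam al z ->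
  \sum_(k < n) (1 + lam k `^ (4 * al)) * dot z (e k) ^+ 2 <=
  graph_norm dot e lam al z ^+ 2.
Proof.
move=> hz; have hc := graph_norm_cvg hz.
rewrite -(cvg_lim _ hc)//; apply: sum_le_tsum; first exact: graph_term_ge0.
by apply/cvg_ex; eexists; exact: hc.
Qed.

Lemma dom_pow_bounded (al B : R) z :
  (forall n, \sum_(k < n) lam k `^ (4 * al) * dot z (e k) ^+ 2 <= B) ->
  dom_pow dot e lam al z.
Proof.
move=> h; apply: (bounded_is_cvg_series _ h) => k.
by rewrite mulr_ge0 ?sqr_ge0// powR_ge0.
Qed.

Lemma graph_sum_dom (al B : R) z :
  (forall n, \sum_(k < n) (1 + lam k `^ (4 * al)) * dot z (e k) ^+ 2 <= B) ->
  dom_pow dot e lam al z.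
Proof.
move=> h; apply: (@dom_pow_bounded al B) => n; apply: le_trans (h n).
by apply: ler_sum => k _; rewrite ler_wpM2r ?sqr_ge0// lerDr.
Qed.

Lemma graph_norm_le_sum (al B : R) z :
  (forall n, \sum_(k < n) (1 + lam k `^ (4 * al)) * dot z (e k) ^+ 2 <= B) ->
  graph_norm dot e lam al z ^+ 2 <= B.
Proof.
move=> h; have hc := graph_norm_cvg (graph_sum_dom h).
rewrite -(cvg_lim _ hc)//; apply: tsum_le => //.
by apply/cvg_ex; eexists; exact: hc.
Qed.

Lemma dom_powB (al : R) x y : dom_pow dot e lam al x -> dom_pow dot e lam al y ->
  dom_pow dot e lam al (x - y).
Proof.
move=> hx hy.
apply: (@graph_sum_dom al (2 * graph_norm dot e lam al x ^+ 2
  + 2 * graph_norm dot e lam al y ^+ 2)) => n.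
apply: le_trans (lerD (ler_wpM2l _ (sum_le_graph_norm n hx))
  (ler_wpM2l _ (sum_le_graph_norm n hy))) => //.
rewrite !mulr_sumr -big_split /=; apply: ler_sum => k _.
rewrite linearBl /= !(mulrCA 2) -mulrDr ler_wpM2l ?addr_ge0 ?powR_ge0//.
rewrite -subr_ge0 [X in 0 <= X](_ : _ = (dot x (e k) + dot y (e k)) ^+ 2) ?sqr_ge0//.
by ring.
Qed.

Lemma graph_norm_bound (al : R) x y : dom_pow dot e lam al x -> dom_pow dot e lam al y ->
  graph_norm dot e lam al x ^+ 2 <=
    2 * graph_norm dot e lam al (x - y) ^+ 2 + 2 * graph_norm dot e lam al y ^+ 2.
Proof.
move=> hx hy; apply: graph_norm_le_sum => n.
apply: le_trans (lerD (ler_wpM2l _ (sum_le_graph_norm n (dom_powB hx hy)))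
  (ler_wpM2l _ (sum_le_graph_norm n hy))) => //.
rewrite !mulr_sumr -big_split /=; apply: ler_sum => k _.
rewrite linearBl /= !(mulrCA 2) -mulrDr ler_wpM2l ?addr_ge0 ?powR_ge0//.
rewrite -subr_ge0 [X in 0 <= X](_ : _ = (dot x (e k) - 2 * dot y (e k)) ^+ 2) ?sqr_ge0//.
by ring.
Qed.

Lemma norm_le_graph_norm (al : R) z : `|z| <= graph_norm dot e lam al z.
Proof.
by rewrite -ler_sqr ?nnegrE ?graph_norm_ge0// graph_norm_sqr lerDl sqr_ge0.
Qed.

(** Convergence in D(A^al) follows from convergence of each coefficient when the
    terms of the series of the squared graph norm are dominated. *)
Lemma graph_norm_cvg0 (I : Type) (F : set_system I) (Z : I -> H) (al : R) b :
  Filter F -> cvgn (series b) -> (forall k, 0 <= b k) ->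
  (\forall s \near F, forall k, (1 + lam k `^ (4 * al)) * dot (Z s) (e k) ^+ 2 <= b k) ->
  (forall k, dot (Z s) (e k) @[s --> F] --> 0) ->
  graph_norm dot e lam al (Z s) @[s --> F] --> 0.
Proof.
move=> FF cb b0 hb hz.
have T := @tannery R I F (fun k s => (1 + lam k `^ (4 * al)) * dot (Z s) (e k) ^+ 2) b FF cb b0.
apply/cvgrPdist_le => eps eps0.
have {}T : \forall s \near F, forall n,
    \sum_(k < n) `|(1 + lam k `^ (4 * al)) * dot (Z s) (e k) ^+ 2| <= eps ^+ 2.
  apply: T; last exact: exprn_gt0.
    by apply: filterS hb => s hs k; rewrite ger0_norm ?graph_term_ge0.
  move=> k; rewrite -[X in _ --> X](_ : (1 + lam k `^ (4 * al)) * (0 * 0) = 0); last first.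
    by rewrite !mulr0.
  apply: cvgM; first exact: cvg_cst.
  by under eq_fun do rewrite expr2; apply: cvgM; exact: hz.
apply: filterS T => s hs; rewrite sub0r normrN ger0_norm ?graph_norm_ge0//.
rewrite -ler_sqr ?nnegrE ?graph_norm_ge0 ?(ltW eps0)//.
apply: graph_norm_le_sum => n; apply: le_trans (hs n).
by apply: ler_sum => k _; exact: ler_norm.
Qed.

End Hilbert.

(** * From solutions to families of modes *)

Section Auxiliary.
Context {R : realType}.
Implicit Types (f m : R -> R) (T S : R).

Lemma bounded_on_segment T f :
  (forall t, 0 <= t <= T -> exists M, \forall s \near within `[0, T] (nbhs t), f s <= M) ->
  exists B, forall t, 0 <= t <= T -> f t <= B.
Proof.
move=> hf.
have := @segment_compact R 0 T => /compact_near_coveringP.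
move=> /(_ R (+oo : set_system R) (fun B t => t \in `[0, T] -> f t <= B) _).
case=> [t /= tT|B [Breal hB]].
  have [M hM] := hf t tT; move: hM; rewrite near_withinE => -[U /= U0 hU].
  exists (ball t U, [set B | M <= B]).
    by split; [exact: nbhsx_ballx|apply: nbhs_pinfty_ge; exact: num_real].
  by move=> [s B] [/= hs MB] sT; exact: le_trans (hU s hs sT) MB.
exists (B + 1) => t tT; apply: (hB (B + 1)) => //.
by rewrite ltrDl.
Qed.

Lemma class_C1_lipschitz m : class_C1_on `[0, +oo[ m ->
  forall S, 0 <= S -> exists2 M1, 0 <= M1 & forall x y, 0 <= x <= S ->
    0 <= y <= S -> `|m x - m y| <= M1 * `|x - y|.
Proof.
move=> [m' hm /subspace_continuousP hc] S S0.
have sub : `[0, S] `<=` (`[0, +oo[ : set R).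
  by move=> x /=; rewrite !in_itv /= andbT => /andP[].
have [B hB] : exists B, forall t, 0 <= t <= S -> `|m' t| <= B.
  apply: (@bounded_on_segment S (fun t => `|m' t|)) => t tS.
  exists (`|m' t| + 1).
  have tI : `[0, +oo[%classic t by apply: sub; rewrite /= in_itv.
  have /cvgrPdist_le/(_ 1 ltr01) := hc t tI.
  rewrite !near_withinE; apply: filterS => s hs sS.
  have := hs (sub s sS); have := ler_normD (m' s - m' t) (m' t).
  by rewrite subrK distrC; lra.
exists B; first by apply: le_trans (hB 0 _); rewrite ?lexx.
move=> x y xS yS; apply: (@deriv_bound_lip _ 0 S m m') => // t tS.
by apply: (has_deriv_at_subset sub); apply: hm; apply: sub; rewrite /= in_itv.
Qed.

(** Used to identify the derivative of a coefficient of u, which the equation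
    leaves unnamed, with the coefficient of u'. *)
Lemma has_deriv_at_unique T f t (l1 l2 : R) : 0 < T -> 0 <= t <= T ->
  has_deriv_at `[0, T] f t l1 -> has_deriv_at `[0, T] f t l2 -> l1 = l2.
Proof.
move=> T0 /andP[t0 tT] h1 h2; apply/eqP; rewrite -subr_eq0; apply/negPn/negP => ne.
have e0 : 0 < `|l1 - l2| / 2 by rewrite divr_gt0 ?normr_gt0.
have /has_deriv_atP/(_ _ e0)[d d0 hd] := has_deriv_atB h1 h2.
have [s sT [st sd]] : exists2 s, 0 <= s <= T & s != t /\ `|s - t| < d.
  have [tT'|Tt] := ltP t T.
    exists (Num.min T (t + d / 2)).
      by rewrite le_min (ltW T0) ge_min lexx /= addr_ge0// divr_ge0// ltW.
    have st : t < Num.min T (t + d / 2) by rewrite lt_min tT' ltrDl divr_gt0.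
    split; first by rewrite gt_eqF.
    rewrite gtr0_norm ?subr_gt0// ltrBlDr gt_min; apply/orP; right.
    by rewrite addrC ltrD2r ltr_pdivrMr// ltr_pMr// ltr1n.
  have {Tt} tT1 : t = T by apply/eqP; rewrite eq_le tT.
  exists (Num.max 0 (t - d / 2)).
    by rewrite le_max lexx /= ge_max (ltW T0) lerBlDr -tT1 lerDl divr_ge0// ltW.
  have st : Num.max 0 (t - d / 2) < t.
    by rewrite gt_max tT1 T0 /= ltrBlDr ltrDl divr_gt0.
  split; first by rewrite lt_eqF.
  rewrite distrC gtr0_norm ?subr_gt0// ltrBlDl -ltrBlDr lt_max; apply/orP; right.
  by rewrite ltrD2l ltrN2 ltr_pdivrMr// ltr_pMr// ltr1n.
have := hd s; rewrite /= in_itv /= => /(_ sT sd).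
rewrite !subrr sub0r normrN normrM ler_pM2r ?normr_gt0 ?subr_eq0//.
by rewrite ler_pdivlMr// ger_pMr ?normr_gt0// lern1.
Qed.

End Auxiliary.

Section Kirchhoff.
Context {R : realType} {H : completeNormedModType R}.
Variables (dot : {dot H for idfun}) (e : nat -> H).
Hypotheses (hdot : norm_from_dot dot) (he : orthonormal_basis dot e).
Variables (lam : nat -> R) (m : R -> R) (nu0 : R).
Hypothesis lam0 : forall k, 0 <= lam k.
Hypothesis nu00 : 0 < nu0.
Hypothesis m_ge : forall s, 0 <= s -> nu0 <= m s.
Hypothesis m_lip : forall S, 0 <= S -> exists2 M1, 0 <= M1 &
  forall x y, 0 <= x <= S -> 0 <= y <= S -> `|m x - m y| <= M1 * `|x - y|.

Definition modes_of (u : R -> H) : nat -> R -> R := fun k t => dot (u t) (e k).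

Lemma weight34 k : lam k `^ (4 * (3 / 4)) = lam k ^+ 3.
Proof. by apply: (powR4E lam0); rewrite mulrC divfK. Qed.

Lemma weight14 k : lam k `^ (4 * (1 / 4)) = lam k.
Proof. by rewrite (powR4E lam0 (n := 1)) ?expr1// mulrC divfK. Qed.

Lemma weight12 k : lam k `^ (4 * (1 / 2)) = lam k ^+ 2.
Proof. by apply: (powR4E lam0); lra. Qed.

(** The inclusions of D(A^(3/4)) in D(A^(1/2)) and in D(A^(1/4)) at the level of
    weights. *)
Lemma le_weight (x : R) : 0 <= x -> x ^+ 2 <= 1 + x ^+ 3 /\ x <= 1 + x ^+ 3.
Proof.
move=> x0; have [x1|x1] := leP x 1.
  have h2 : x ^+ 2 <= 1 by rewrite expr_le1.
  have h3 : 0 <= x ^+ 3 by rewrite exprn_ge0.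
  by split; lra.
have h2 : x ^+ 2 <= x ^+ 3 by rewrite ler_eXn2l.
have h3 : x <= x ^+ 3 by rewrite -{1}(expr1 x) ler_eXn2l.
by split; lra.
Qed.

Lemma dom_pow_half z : dom_pow dot e lam (3 / 4) z -> dom_pow dot e lam (1 / 2) z.
Proof.
move=> hz; apply: (@dom_pow_bounded _ _ _ _ _ _ (graph_norm dot e lam (3 / 4) z ^+ 2)) => n.
apply: le_trans (sum_le_graph_norm hdot he n hz).
apply: ler_sum => k _; rewrite weight34 weight12 ler_wpM2r ?sqr_ge0//.
exact: (le_weight (lam0 k)).1.
Qed.

Lemma sigma_op_pow u t : dom_pow dot e lam (3 / 4) (u t) ->
  `|op_pow dot e lam (1 / 2) (u t)| ^+ 2 = sigma lam (modes_of u) t.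
Proof.
move=> /dom_pow_half hz; rewrite -(cvg_lim _ (op_pow_normsq hdot he hz))//.
rewrite /sigma /tsum; congr (limn (series _)); apply/funext => k.
by rewrite weight12.
Qed.

Lemma sum_energy_le_graph z z' n : dom_pow dot e lam (3 / 4) z ->
  dom_pow dot e lam (1 / 4) z' ->
  \sum_(k < n) (1 + lam k) * (dot z' (e k) ^+ 2 + lam k ^+ 2 * dot z (e k) ^+ 2) <=
  graph_norm dot e lam (1 / 4) z' ^+ 2 + 2 * graph_norm dot e lam (3 / 4) z ^+ 2.
Proof.
move=> hz hz'.
apply: le_trans (lerD (sum_le_graph_norm hdot he n hz')
  (ler_wpM2l _ (sum_le_graph_norm hdot he n hz))) => //.
rewrite mulr_sumr -big_split /=; apply: ler_sum => k _.
rewrite weight34 weight14 mulrDr lerD2l (mulrA 2) (mulrA (1 + lam k)).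
rewrite ler_wpM2r ?sqr_ge0//.
have [h _] := le_weight (lam0 k); have h3 : 0 <= lam k ^+ 3 by rewrite exprn_ge0.
have -> : (1 + lam k) * lam k ^+ 2 = lam k ^+ 2 + lam k ^+ 3 by ring.
lra.
Qed.

Lemma energy_bound (z z' : R -> H) t eta : dom_pow dot e lam (3 / 4) (z t) ->
  dom_pow dot e lam (1 / 4) (z' t) ->
  (forall n, \sum_(k < n) (1 + lam k) *
     (dot (z' t) (e k) ^+ 2 + lam k ^+ 2 * dot (z t) (e k) ^+ 2) <= eta) ->
  energy dot e lam z z' t <= eta.
Proof.
move=> hz hz' hsum.
set f1 := series (fun k => dot (z' t) (e k) ^+ 2).
set f2 := series (fun k => lam k `^ (4 * (1 / 4)) * dot (z' t) (e k) ^+ 2).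
set f3 := series (fun k => lam k `^ (4 * (1 / 2)) * dot (z t) (e k) ^+ 2).
set f4 := series (fun k => lam k `^ (4 * (3 / 4)) * dot (z t) (e k) ^+ 2).
have hc : (fun n => f1 n + f2 n + f3 n + f4 n) @ \oo --> energy dot e lam z z' t.
  apply: cvgD; last exact: op_pow_normsq.
  apply: cvgD; last by apply: op_pow_normsq => //; exact: dom_pow_half.
  by apply: cvgD; [exact: parseval|exact: op_pow_normsq].
rewrite -(cvg_lim _ hc)//; apply: limr_le.
  by apply/cvg_ex; eexists; exact: hc.
apply: nearW => n; apply: le_trans (hsum n).
rewrite /f1 /f2 /f3 /f4 !seriesE -!big_split /=.
apply: ler_sum => k _; rewrite weight34 weight14 weight12.
by rewrite le_eqVlt; apply/orP; left; apply/eqP; ring.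
Qed.

(** A continuous function on a compact interval is bounded; continuity gives the
    local bounds. *)
Lemma graph_norm_bounded T (al : R) u : C0_dom_pow dot e lam `[0, T] al u ->
  exists B, forall t, 0 <= t <= T -> graph_norm dot e lam al (u t) ^+ 2 <= B.
Proof.
move=> [hd hc]; apply: bounded_on_segment => t tT.
have tI : `[0, T]%classic t by rewrite /= in_itv.
exists (2 * 1 + 2 * graph_norm dot e lam al (u t) ^+ 2).
have /cvgrPdist_le/(_ 1 ltr01) := hc t tI.
rewrite !near_withinE; apply: filterS => s hs sI.
apply: le_trans (graph_norm_bound hdot he (hd s sI) (hd t tI)) _.
rewrite lerD2r ler_wpM2l// expr_le1 ?graph_norm_ge0//.
by have := hs sI; rewrite sub0r normrN ger0_norm ?graph_norm_ge0.
Qed.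

(** The energy of a solution is bounded on [0, T] because u and u' are continuous
    into D(A^(3/4)) and D(A^(1/4)). *)
Lemma solution_modes T u0 u1 u u' : 0 < T -> solution_on dot e lam m T u0 u1 u u' ->
  exists S, nonlinear_solution lam m T S (modes_of u) (modes_of u').
Proof.
move=> T0 [hu [hu14 hd hu'] h2 _ _].
have [B1 hB1] := graph_norm_bounded hu; have [B2 hB2] := graph_norm_bounded hu'.
have inI t : 0 <= t <= T -> `[0, T]%classic t by rewrite /= in_itv.
have d1 k t : 0 <= t <= T -> has_deriv_at `[0, T] (modes_of u k) t (modes_of u' k t).
  move=> tT; apply/cvgrPdist_le => eps eps0.
  have /cvgrPdist_le/(_ _ eps0) := hd t (inI t tT).
  apply: filterS => s; rewrite sub0r normrN ger0_norm ?graph_norm_ge0//.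
  apply: le_trans; apply: le_trans (norm_le_graph_norm _ _ _ _ _).
  apply: le_trans (dot_basis_le hdot he _ k).
  have -> : dot ((s - t)^-1 *: (u s - u t) - u' t) (e k) =
      (s - t)^-1 * (dot (u s) (e k) - dot (u t) (e k)) - dot (u' t) (e k).
    by rewrite linearBl linearZl_LR linearBl.
  by rewrite distrC /modes_of mulrC.
exists (B2 + 2 * B1); split=> [k|t tT n]; last first.
  apply: le_trans (sum_energy_le_graph n (hu.1 t (inI t tT)) (hu'.1 t (inI t tT))) _.
  by rewrite lerD ?hB2// ler_wpM2l// hB1.
split=> [t tT|t tT]; first exact: d1.
have [f' hf' hf''] := h2 k.
have eqf s : 0 <= s <= T -> f' s = modes_of u' k s.
  by move=> sT; apply: (has_deriv_at_unique T0 sT (hf' s (inI s sT))); exact: d1.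
have := hf'' t (inI t tT); rewrite (sigma_op_pow (hu.1 t (inI t tT))).
apply: (eq_has_deriv_at (inI t tT)) => s.
by rewrite inE /= in_itv /= => /eqf.
Qed.

End Kirchhoff.

(** * From families of modes to solutions *)

Section Realization.
Context {R : realType} {H : completeNormedModType R}.
Variables (dot : {dot H for idfun}) (e : nat -> H).
Hypotheses (hdot : norm_from_dot dot) (he : orthonormal_basis dot e).
Variables (lam : nat -> R) (m : R -> R) (nu0 : R).
Hypothesis lam0 : forall k, 0 <= lam k.
Hypothesis nu00 : 0 < nu0.
Hypothesis m_ge : forall s, 0 <= s -> nu0 <= m s.
Hypothesis m_lip : forall S, 0 <= S -> exists2 M1, 0 <= M1 &
  forall x y, 0 <= x <= S -> 0 <= y <= S -> `|m x - m y| <= M1 * `|x - y|.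

Lemma nonlinear_mode_growth T B v v' : 0 <= T -> nonlinear_solution lam m T B v v' ->
  exists2 C, 0 <= C & forall k t, 0 <= t <= T ->
    mode_energy (lam k) (v k) (v' k) t <= C * mode_energy (lam k) (v k) (v' k) 0.
Proof.
move=> T0 [hv vB].
have B0 : 0 <= B by apply: (energy_le_ge0 (vB 0 _)); rewrite lexx.
have [M1 M10 hM1] := m_lip B0.
have hc := coefficient_admissible lam0 m_ge B0 M10 hM1 hv vB.
have nu_gt0 : 0 < Num.min nu0 1 by rewrite lt_min nu00 ltr01.
have nu_le1 : Num.min nu0 1 <= 1 by rewrite ge_min lexx orbT.
have L0 : 0 <= M1 * B by exact: mulr_ge0.
have M_ge1 : 1 <= m 0 + M1 * B + 1.
  by rewrite lerDr addr_ge0// (le_trans (ltW nu00) (m_ge (lexx 0))).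
exists (growth_const T (Num.min nu0 1) (m 0 + M1 * B + 1) (M1 * B)).
  exact: growth_const_ge0.
by move=> k t tT; exact: (mode_energy_growth nu_gt0 nu_le1 M_ge1 L0 hc (hv k) tT).
Qed.

(** All the continuity required of a solution follows by domination.  The growth
    estimate bounds (1 + lam^3) V^2 and (1 + lam) V'^2, uniformly in time, by
    the terms b k of a convergent series; the difference quotients of V satisfy
    the same bound as V'. *)
Lemma modes_realization T B u0 u1 v v' : 0 < T ->
  nonlinear_solution lam m T B v v' ->
  (forall k, v k 0 = dot u0 (e k)) -> (forall k, v' k 0 = dot u1 (e k)) ->
  exists u u', solution_on dot e lam m T u0 u1 u u'.
Proof.
move=> T0 hsol v0 v0'.
have T0' := ltW T0.
have h0T : 0 <= (0:R) <= T by rewrite lexx.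
have [C C0 growth] := nonlinear_mode_growth T0' hsol.
have [hv vB] := hsol.
pose N k := mode_energy (lam k) (v k) (v' k) 0.
have N0 k : 0 <= N k by exact: mode_energy_ge0.
have E0 k := energy_term_ge0 lam0 v v' 0 k.
have cE := bounded_is_cvg_series E0 (vB 0 h0T).
(* The term v k 0 is needed since the energy does not see V when lam k = 0. *)
pose b k := 2 * v k 0 ^+ 2 + (2 * T ^+ 2 + 2) * (C * energy_term lam v v' 0 k).
have K0 : 0 <= 2 * T ^+ 2 + 2 by rewrite addr_ge0// mulr_ge0// sqr_ge0.
have b0 k : 0 <= b k.
  exact: addr_ge0 (mulr_ge0 (ler0n R 2) (sqr_ge0 _)) (mulr_ge0 K0 (mulr_ge0 C0 (E0 k))).
have cb a : cvgn (series (fun k => a * b k)).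
  rewrite (_ : (fun k => a * b k) = a *: (2 *: (fun k => dot u0 (e k) ^+ 2) +
     ((2 * T ^+ 2 + 2) * C) *: (fun k => energy_term lam v v' 0 k))).
    apply: is_cvg_seriesZ; apply: is_cvg_seriesD; apply: is_cvg_seriesZ => //.
    by apply/cvg_ex; eexists; exact: parseval.
  by apply/funext => k; rewrite /b v0 !fctE mulrA.
(* Freezing the modes outside [0, T] makes the bounds hold at all times. *)
pose V k t := v k (clamp T t); pose V' k t := v' k (clamp T t).
have clT t : 0 <= clamp T t <= T by exact: clampP.
have VE k t : 0 <= t <= T -> V k t = v k t by move=> tT; rewrite /V clamp_id.
have VE' k t : 0 <= t <= T -> V' k t = v' k t by move=> tT; rewrite /V' clamp_id.
have inI t : 0 <= t <= T -> `[0, T]%classic t by rewrite /= in_itv.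
have dV k t : 0 <= t <= T -> has_deriv_at `[0, T] (V k) t (V' k t).
  move=> tT; rewrite VE'//; apply: (eq_has_deriv_at (inI t tT)) ((hv k).1 t tT).
  by move=> s; rewrite inE /= in_itv /= => /VE ->.
have dV' k t : 0 <= t <= T -> has_deriv_at `[0, T] (V' k) t
    (- (m (sigma lam v t) * lam k ^+ 2 * V k t)).
  move=> tT; rewrite VE//; apply: (eq_has_deriv_at (inI t tT)) ((hv k).2 t tT).
  by move=> s; rewrite inE /= in_itv /= => /VE' ->.
have CN0 k : 0 <= C * N k by exact: mulr_ge0 C0 (N0 k).
have V'N k t : V' k t ^+ 2 <= C * N k.
  apply: le_trans (growth k _ (clT t)).
  by rewrite /mode_energy lerDl sqrM_ge0.
have LVN k t : lam k ^+ 2 * V k t ^+ 2 <= C * N k.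
  apply: le_trans (growth k _ (clT t)).
  by rewrite /mode_energy lerDr sqr_ge0.
have lipV k s t : `|V k t - V k s| <= Num.sqrt (C * N k) * `|t - s|.
  apply: le_trans (_ : Num.sqrt (C * N k) * `|clamp T t - clamp T s| <= _); last first.
    by rewrite ler_wpM2l ?sqrtr_ge0// clamp_lip.
  apply: (deriv_bound_lip (hv k).1) => // r rT.
  rewrite -[X in X <= _]ger0_norm// -sqrtr_sqr ler_wsqrtr// real_normK ?num_real//.
  by rewrite -VE'.
have lipV2 k s t : (V k t - V k s) ^+ 2 <= C * N k * (t - s) ^+ 2.
  rewrite -[X in X <= _]real_normK ?num_real// -[X in _ * X]real_normK ?num_real//.
  rewrite -[C * N k]sqr_sqrtr// -exprMn.
  by apply: lerXn2r (lipV k s t); rewrite nnegrE /= ?mulr_ge0 ?sqrtr_ge0 ?normr_ge0.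
have CE k : C * energy_term lam v v' 0 k = (1 + lam k) * (C * N k).
  by rewrite /energy_term mulrCA.
have lamp k : 0 <= 1 + lam k by rewrite addr_ge0.
have bV' k t : (1 + lam k) * V' k t ^+ 2 <= C * energy_term lam v v' 0 k.
  by rewrite CE ler_wpM2l.
have CEb k : 2 * (C * energy_term lam v v' 0 k) <= b k.
  have h := mulr_ge0 C0 (E0 k).
  have h1 := mulr_ge0 (sqr_ge0 T) h; have h2 := sqr_ge0 (v k 0).
  by rewrite /b mulrDl; lra.
have bV k t : (1 + lam k ^+ 3) * V k t ^+ 2 <= b k.
  have h1 : lam k ^+ 3 * V k t ^+ 2 <= C * energy_term lam v v' 0 k.
    rewrite CE; apply: le_trans (ler_wpM2l (lamp k) (LVN k t)).
    have h := sqrM_ge0 (lam k) (V k t).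
    have -> : lam k ^+ 3 * V k t ^+ 2 = lam k * (lam k ^+ 2 * V k t ^+ 2) by ring.
    by rewrite ler_wpM2r// lerDr.
  have h2 : V k t ^+ 2 <= 2 * v k 0 ^+ 2 + 2 * T ^+ 2 * (C * energy_term lam v v' 0 k).
    have h3 := lipV2 k 0 (clamp T t).
    have h4 : C * N k * (clamp T t - 0) ^+ 2 <= T ^+ 2 * (C * energy_term lam v v' 0 k).
      rewrite mulrC subr0; apply: ler_pM => //; first exact: sqr_ge0.
        by have /andP[c0 cT] := clT t; rewrite lerXn2r ?nnegrE.
      by rewrite CE ler_peMl// lerDl.
    have := le_trans h3 h4.
    rewrite (_ : V k (clamp T t) = V k t); last by rewrite /V (clamp_id (clT t)).
    rewrite (VE k 0 h0T) => h5.
    have : V k t ^+ 2 <= 2 * v k 0 ^+ 2 + 2 * (V k t - v k 0) ^+ 2.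
      rewrite -subr_ge0 [X in 0 <= X](_ : _ = (V k t - 2 * v k 0) ^+ 2) ?sqr_ge0//.
      by ring.
    by move=> h6; rewrite -mulrA; lra.
  have h3 := mulr_ge0 C0 (E0 k).
  rewrite /b mulrDl mul1r mulrDl; lra.
have V2b k t : V k t ^+ 2 <= b k.
  apply: le_trans (bV k t); rewrite ler_peMl ?sqr_ge0// lerDl.
  by rewrite exprn_ge0.
have V'2b k t : V' k t ^+ 2 <= b k.
  apply: le_trans (_ : (1 + lam k) * V' k t ^+ 2 <= _).
    by rewrite ler_peMl ?sqr_ge0// lerDl.
  have h := mulr_ge0 C0 (E0 k).
  by apply: le_trans (bV' k t) _; apply: le_trans (CEb k); lra.
have cb1 : cvgn (series b).
  by have := cb 1; congr (cvgn (series _)); apply/funext => k; rewrite mul1r.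
have sumb n : \sum_(k < n) b k <= tsum b by exact: sum_le_tsum.
have synth (W : nat -> R) : (forall k, W k ^+ 2 <= b k) ->
    forall k, dot (limn (series (fun k => W k *: e k))) (e k) = W k.
  move=> hW; apply: (dot_series_lim hdot he).
  apply: (riesz_fischer hdot he).
  apply: (@bounded_is_cvg_series _ _ (tsum b)) => [k|n]; first exact: sqr_ge0.
  by apply: le_trans (sumb n); apply: ler_sum => k _; exact: hW.
pose u t := limn (series (fun k => V k t *: e k)).
pose u' t := limn (series (fun k => V' k t *: e k)).
have uE t k : dot (u t) (e k) = V k t by exact: (synth (V^~ t) (V2b^~ t)).
have uE' t k : dot (u' t) (e k) = V' k t by exact: (synth (V'^~ t) (V'2b^~ t)).
have w34 k := weight34 lam0 k; have w14 k := weight14 lam0 k.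
have dom34 t : dom_pow dot e lam (3 / 4) (u t).
  apply: (graph_sum_dom (B := tsum b)) => n; apply: le_trans (sumb n).
  by apply: ler_sum => k _; rewrite w34 uE.
have dom14 t : dom_pow dot e lam (1 / 4) (u' t).
  apply: (graph_sum_dom (B := tsum b)) => n; apply: le_trans (sumb n).
  apply: ler_sum => k _; rewrite w14 uE'; apply: le_trans (bV' k t) _.
  by apply: le_trans (CEb k); have := mulr_ge0 C0 (E0 k); lra.
have bV1 k t : (1 + lam k) * V k t ^+ 2 <= 2 * b k.
  apply: le_trans (_ : 2 * (1 + lam k ^+ 3) * V k t ^+ 2 <= _); last first.
    by rewrite -mulrA ler_wpM2l.
  rewrite ler_wpM2r ?sqr_ge0//.
  have [_ h] := le_weight (lam0 k); have : 0 <= lam k ^+ 3 by rewrite exprn_ge0.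
  lra.
have dom14u t : dom_pow dot e lam (1 / 4) (u t).
  apply: (graph_sum_dom (B := 2 * tsum b)) => n.
  apply: le_trans (ler_wpM2l _ (sumb n)) => //; rewrite mulr_sumr.
  by apply: ler_sum => k _; rewrite w14 uE.
have sqB (x y : R) : (x - y) ^+ 2 <= 2 * x ^+ 2 + 2 * y ^+ 2.
  rewrite -subr_ge0 [X in 0 <= X](_ : _ = (x + y) ^+ 2) ?sqr_ge0//.
  by ring.
have contV k t : 0 <= t <= T -> (fun s => V k s - V k t) @ within `[0, T] (nbhs t) --> 0.
  move=> tT; rewrite -[X in _ --> X](subrr (V k t)); apply: cvgB; last exact: cvg_cst.
  exact: has_deriv_at_cont (dV k t tT).
have contV' k t : 0 <= t <= T -> (fun s => V' k s - V' k t) @ within `[0, T] (nbhs t) --> 0.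
  move=> tT; rewrite -[X in _ --> X](subrr (V' k t)); apply: cvgB; last exact: cvg_cst.
  exact: has_deriv_at_cont (dV' k t tT).
have C034 : C0_dom_pow dot e lam `[0, T] (3 / 4) u.
  split=> [t _|t tI]; first exact: dom34.
  have tT : 0 <= t <= T by move: tI; rewrite /= in_itv.
  apply: (graph_norm_cvg0 hdot he (b := fun k => 4 * b k) _ (cb 4)).
  - by move=> k; rewrite mulr_ge0.
  - apply: nearW => s k; rewrite w34 linearBl /= !uE.
    have w0 : 0 <= 1 + lam k ^+ 3 by rewrite addr_ge0// exprn_ge0.
    have := ler_wpM2l w0 (sqB (V k s) (V k t)).
    by have := bV k s; have := bV k t; lra.
  - move=> k; rewrite (_ : (fun s => _) = fun s => V k s - V k t); first exact: contV.
    by apply/funext => s; rewrite linearBl /= !uE.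
have C014 : C0_dom_pow dot e lam `[0, T] (1 / 4) u.
  split=> [t _|t tI]; first exact: dom14u.
  have tT : 0 <= t <= T by move: tI; rewrite /= in_itv.
  apply: (graph_norm_cvg0 hdot he (b := fun k => 8 * b k) _ (cb 8)).
  - by move=> k; rewrite mulr_ge0.
  - apply: nearW => s k; rewrite w14 linearBl /= !uE.
    have := ler_wpM2l (lamp k) (sqB (V k s) (V k t)).
    by have := bV1 k s; have := bV1 k t; lra.
  - move=> k; rewrite (_ : (fun s => _) = fun s => V k s - V k t); first exact: contV.
    by apply/funext => s; rewrite linearBl /= !uE.
have C014' : C0_dom_pow dot e lam `[0, T] (1 / 4) u'.
  split=> [t _|t tI]; first exact: dom14.
  have tT : 0 <= t <= T by move: tI; rewrite /= in_itv.
  apply: (graph_norm_cvg0 hdot he (b := fun k => 4 * b k) _ (cb 4)).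
  - by move=> k; rewrite mulr_ge0.
  - apply: nearW => s k; rewrite w14 linearBl /= !uE'.
    have := ler_wpM2l (lamp k) (sqB (V' k s) (V' k t)).
    have := mulr_ge0 C0 (E0 k).
    by have := bV' k s; have := bV' k t; have := CEb k; lra.
  - move=> k; rewrite (_ : (fun s => _) = fun s => V' k s - V' k t); first exact: contV'.
    by apply/funext => s; rewrite linearBl /= !uE'.
exists u, u'; split; first exact: C034.
- split; [exact: C014| |exact: C014'] => t tI.
  have tT : 0 <= t <= T by move: tI; rewrite /= in_itv.
  have dotE s k : dot ((s - t)^-1 *: (u s - u t) - u' t) (e k) =
      (V k s - V k t) / (s - t) - V' k t.
    by rewrite linearBl linearZl_LR linearBl /=; rewrite !uE uE' mulrC.
  have FF : Filter (within `[0, T] t^') by exact: within_filter.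
  apply: (graph_norm_cvg0 hdot he (b := fun k => 4 * b k) FF (cb 4)).
  + by move=> k; rewrite mulr_ge0.
  + apply: nearW => s k; rewrite w14 dotE.
    have q : ((V k s - V k t) / (s - t)) ^+ 2 <= C * N k.
      have [->|st] := eqVneq s t; first by rewrite subrr mul0r expr0n.
      by rewrite exprMn exprVn ler_pdivrMr ?lipV2// exprn_even_gt0//= subr_eq0.
    have := ler_wpM2l (lamp k) (sqB ((V k s - V k t) / (s - t)) (V' k t)).
    have := ler_wpM2l (lamp k) q; rewrite -CE.
    have := mulr_ge0 C0 (E0 k).
    by have := bV' k t; have := CEb k; lra.
  + move=> k; rewrite (_ : (fun s => _) = (fun s => (V k s - V k t) / (s - t) - V' k t)); last first.
      by apply/funext => s; rewrite dotE.
    rewrite -[X in _ --> X](subrr (V' k t)); apply: cvgB; last exact: cvg_cst.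
    exact: dV.
- move=> k; exists (V' k).
    rewrite (_ : (fun t => dot (u t) (e k)) = V k); last by apply/funext => t; rewrite uE.
    by move=> t tI; apply: dV; move: tI; rewrite /= in_itv.
  move=> t tI.
  have tT : 0 <= t <= T by move: tI; rewrite /= in_itv.
  have := dV' k t tT.
  rewrite (sigma_op_pow hdot he lam0 (dom34 t)) uE.
  rewrite (_ : sigma lam (modes_of dot e u) t = sigma lam v t)//.
  rewrite /sigma /tsum; congr (limn (series _)); apply/funext => j.
  by rewrite /modes_of uE VE.
- by apply: (basis_inj hdot he) => k; rewrite uE VE// v0.
- by apply: (basis_inj hdot he) => k; rewrite uE' VE'// v0'.
Qed.

End Realization.

(** * Continuous dependence and life span *)

Theorem corollary2p3 (R : realType) (H : completeNormedModType R)
    (dot : {dot H for idfun}) (hdot : norm_from_dot dot)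
    (DA : set H) (A : H -> H) (hA : self_adjoint dot DA A)
    (e : nat -> H) (he : orthonormal_basis dot e)
    (lam : nat -> R) (hlam : forall k, 0 <= lam k)
    (hAe : forall k, DA (e k) /\ A (e k) = lam k ^+ 2 *: e k)
    (m : R -> R) (hm : class_C1_on `[0, +oo[ m)
    (nu0 : R) (hnu0 : 0 < nu0) (hmnu : forall s : R, 0 <= s -> nu0 <= m s)
    (u0 u1 : H)
    (hu0 : dom_pow dot e lam (3 / 4) u0) (hu1 : dom_pow dot e lam (1 / 4) u1)
    (u u' : R -> H) (hu : global_solution dot e lam m u0 u1 u u')
    (u0e u1e : R -> H)
    (hu0e : forall eps : R, 0 < eps -> dom_pow dot e lam (3 / 4) (u0e eps))
    (hu1e : forall eps : R, 0 < eps -> dom_pow dot e lam (1 / 4) (u1e eps))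
    (cvg0 : graph_norm dot e lam (3 / 4) (u0e eps - u0) @[eps --> 0^'+] --> 0)
    (cvg1 : graph_norm dot e lam (1 / 4) (u1e eps - u1) @[eps --> 0^'+] --> 0)
    (ue ue' : R -> R -> H)
    (hue : forall eps : R, 0 < eps ->
       maximal_solution dot e lam m (u0e eps) (u1e eps) (ue eps) (ue' eps)) :
  life_span dot e lam m (u0e eps) (u1e eps) @[eps --> 0^'+] --> +oo%E /\
  (forall T : R, 0 < T ->
     {uniform `[0, T],
       (fun eps => energy dot e lam (ue eps \- u) (ue' eps \- u')) @ 0^'+
         --> (fun=> 0)}).

Proof.
have m_lip := class_C1_lipschitz hm.
(* Both assertions come from the same construction on [0, T]: a solution exists
   there, and every solution is close to u. *)
have key T eta : 0 < T -> 0 < eta -> eta <= 1 -> \forall eps \near 0^'+,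
    (T%:E <= life_span dot e lam m (u0e eps) (u1e eps))%E /\
    forall w w', solution_on dot e lam m T (u0e eps) (u1e eps) w w' ->
      forall t, 0 <= t <= T -> energy dot e lam (w \- u) (w' \- u') t <= eta.
  move=> T0 eta0 eta1; have T0' := ltW T0.
  have hT := hu T T0.
  have [B hB] := solution_modes hdot he hlam T0 hT.
  have [gam gam0 hgam] := nonlinear_modes_stability hlam hnu0 hmnu m_lip T0' hB eta0 eta1.
  (* 3 because the energy at time 0 is at most the square of the distance of the
   second data plus twice that of the first. *)
  pose r := Num.min 1 (gam / 3).
  have r0 : 0 < r by rewrite lt_min ltr01 divr_gt0.
  have r1 : r ^+ 2 <= gam / 3.
    apply: le_trans (_ : r <= _); last by rewrite ge_min lexx orbT.
    by rewrite expr2 ler_piMr ?(ltW r0)// ge_min lexx.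
  have /cvgrPdist_le/(_ r r0) near0 := cvg0.
  have /cvgrPdist_le/(_ r r0) near1 := cvg1.
  near=> eps.
  have eps0 : 0 < eps by near: eps; exact: nbhs_right_gt.
  have g0 : graph_norm dot e lam (3 / 4) (u0e eps - u0) ^+ 2 <= gam / 3.
    apply: le_trans r1; rewrite lerXn2r ?nnegrE ?graph_norm_ge0 ?(ltW r0)//.
    rewrite -(ger0_norm (graph_norm_ge0 _ _ _ _ _)) -normrN -sub0r.
    by near: eps.
  have g1 : graph_norm dot e lam (1 / 4) (u1e eps - u1) ^+ 2 <= gam / 3.
    apply: le_trans r1; rewrite lerXn2r ?nnegrE ?graph_norm_ge0 ?(ltW r0)//.
    rewrite -(ger0_norm (graph_norm_ge0 _ _ _ _ _)) -normrN -sub0r.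
    by near: eps.
  have d0 := dom_powB hdot he (hu0e eps eps0) hu0.
  have d1 := dom_powB hdot he (hu1e eps eps0) hu1.
  have [_ _ _ uu0 uu1] := hT.
  have small n : \sum_(k < n) (1 + lam k) *
     ((dot (u1e eps) (e k) - modes_of dot e u' k 0) ^+ 2 + lam k ^+ 2 *
      (dot (u0e eps) (e k) - modes_of dot e u k 0) ^+ 2) <= gam.
    rewrite /modes_of uu0 uu1.
    have := sum_energy_le_graph hdot he hlam n d0 d1.
    under eq_bigr do rewrite !linearBl /=.
    by move/le_trans; apply; lra.
  have [v [v' [va vb vsol vclose]]] :=
    hgam (fun k => dot (u0e eps) (e k)) (fun k => dot (u1e eps) (e k)) small.
  split.
    have [w [w' hw]] := modes_realization hdot he hlam hnu0 hmnu m_lip T0 vsol va vb.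
    by apply: ereal_sup_ubound; exists T => //; split=> //; exists w, w'.
  move=> w w' hw t tT.
  have [S hS] := solution_modes hdot he hlam T0 hw.
  have [[hw34 _] [_ _ [hw14 _]] _ w0 w1] := hw.
  have [[hu34 _] [_ _ [hu14 _]] _ _ _] := hT.
  have tI : `[0, T]%classic t by rewrite /= in_itv.
  have e0 k : v k 0 = modes_of dot e w k 0 by rewrite va /modes_of w0.
  have e1 k : v' k 0 = modes_of dot e w' k 0 by rewrite vb /modes_of w1.
  have close := nonlinear_solution_close hlam hnu0 hmnu m_lip T0' vsol hS e0 e1 vclose tT.
  apply: (energy_bound hdot he hlam).
  - exact: (dom_powB hdot he (hw34 t tI) (hu34 t tI)).
  - exact: (dom_powB hdot he (hw14 t tI) (hu14 t tI)).
  - move=> n; apply: le_trans (close n); apply: ler_sum => k _.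
    by rewrite /energy_term /mode_energy /sub_modes /modes_of /= !linearBl.
split.
  apply/cvgeyPge => a.
  have a0 : 0 < Num.max a 1 by rewrite lt_max ltr01 orbT.
  apply: filterS (key _ 1 a0 ltr01 (lexx 1)) => eps [h _]; apply: le_trans h.
  by rewrite lee_fin le_max lexx.
move=> T T0 P /uniform_nbhs[E [entE EP]].
move: entE; rewrite -entourage_ballE => -[rad /= rad0 Erad].
have T1 : 0 < T + 1 by rewrite addr_gt0.
pose eta := Num.min 1 (rad / 2).
have eta0 : 0 < eta by rewrite lt_min ltr01 divr_gt0.
have eta1 : eta <= 1 by rewrite ge_min lexx.
have etar : eta < rad.
  by rewrite gt_min; apply/orP; right; rewrite ltr_pdivrMr// ltr_pMr// ltr1n.
(* Existence up to T + 1 makes T smaller than the life span. *)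
have key1 := key (T + 1) 1 T1 ltr01 (lexx 1).
have key2 := key T eta T0 eta0 eta1.
change (\forall eps \near 0^'+, P (energy dot e lam (ue eps \- u) (ue' eps \- u'))).
apply: filterS3 key1 key2 (nbhs_right_gt 0) => eps [life _] [_ close] eps0.
apply: EP => t /= tI; apply: Erad; rewrite /= /ball /= sub0r normrN.
have tT : 0 <= t <= T by move: tI; rewrite in_itv.
rewrite ger0_norm; last by rewrite /energy !addr_ge0// sqr_ge0.
apply: le_lt_trans (close _ _ _ t tT) etar; apply: hue => //.
by apply: lt_le_trans life; rewrite lte_fin ltrDl.
Unshelve. all: by end_near.
Qed.
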